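(* Let $2\le q<\infty$, let $A\colon D(A)\subset X\to X$ be the generator of a diagonal semigroup with respect to a $q$-Riesz basis of $X$, and let $n\in\mathbb{N}$. Then for every $B\in\mathfrak{B}_{L^\infty}(A,\mathbb{C}^n)$ there exists an $N$-function $\Phi$ such that $B\in\mathfrak{B}_{L^\Phi}(A,\mathbb{C}^n)$.
   Context: Let $X$ be a complex Banach space. A $q$-Riesz basis of $X$ is a Schauder basis $(\phi_k)_{k\in\mathbb{Z}}$ for which there are $C_1,C_2>0$ with $C_1\sum_k|a_k|^q\le\|\sum_ka_k\phi_k\|^q\le C_2\sum_k|a_k|^q$ for all finite sequences $(a_k)$. $A$ generates a diagonal semigroup with respect to $(\phi_k)$ if $A$ generates the $C_0$-semigroup $(T(t))_{t\ge0}$ given by $T(t)\phi_k=e^{\lambda_kt}\phi_k$, with $A\phi_k=\lambda_k\phi_k$, where $(\lambda_k)$ lies in some left half-plane of $\mathbb{C}$. $X_{-1}$ is the completion of $X$ with respect to $\|(\beta-A)^{-1}\cdot\|_X$ for some $\beta\in\rho(A)$; the semigroup extends to $X_{-1}$ (same notation). For an Orlicz space $Z$ (including $L^\infty$) and a Banach space $U$, $B\in L(U,X_{-1})$ (bounded linear) is $Z$-admissible for $A$ if $\int_0^{t_0}T(t_0-s)Bu(s)\,ds\in X$ for all $t_0>0$ and $u\in Z(0,t_0;U)$. $\mathfrak{B}_Z(A,U)$ is the set of all $Z$-admissible $B\in L(U,X_{-1})$. A Young function is a function $\Phi\colon[0,\infty)\to[0,\infty]$ of the form $\Phi(t)=\int_0^t\phi(s)\,ds$,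 where $\phi\colon[0,\infty)\to[0,\infty]$ is nondecreasing, left-continuous, and neither constantly $0$ nor constantly $+\infty$. An $N$-function is a real-valued (finite) Young function with $\lim_{x\to0}\Phi(x)/x=\lim_{x\to\infty}x/\Phi(x)=0$. $L^\Phi(J;U)$ consists of the measurable $f\colon J\to U$ for which $\Phi(k^{-1}\|f(\cdot)\|_U)$ is integrable for some $k>0$, with norm $\inf\{k>0:\int_J\Phi(k^{-1}\|f(s)\|_U)\,ds\le1\}$. *)

(* Defs.v *)
From HB Require Import structures.
From mathcomp Require Import all_boot all_order all_algebra finmap.
From mathcomp Require Import complex.
From mathcomp Require Import all_classical all_reals all_analysis.

Set Implicit Arguments.
Unset Strict Implicit.
Unset Printing Implicit Defensive.

Import Order.TTheory GRing.Theory Num.Theory.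
Import numFieldNormedType.Exports.

Local Open Scope classical_set_scope.
Local Open Scope ring_scope.
Local Open Scope complex_scope.

(* A field K is canonically a normed module over itself only when K is a
   variable of a structure type; the concrete R[i] needs the same copy for
   'cV[R[i]]_n to be a normed space.  Its norm is the max norm, which is
   equivalent to the Euclidean one. *)
#[non_forgetful_inheritance]
HB.instance Definition _ (R : rcfType) := NormedModule.copy R[i] (R[i])^o.

(* Norms of normed modules over R[i] are elements of R[i] (with zero imaginary
   part); nrm is the norm as a real number. *)
Definition nrm (R : rcfType) (V : normedZmodType R[i]) (v : V) : R :=
  complex.Re `|v|.

Definition cexp (R : realType) (z : R[i]) : R[i] :=
  (expR (complex.Re z))%:C * (cos (complex.Im z) +i* sin (complex.Im z)).

Section Integral.
Context {R : realType}.
Local Notation mu := (@lebesgue_measure R).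
Implicit Types (V : normedModType R[i]) (D : set R).

Definition simple_function V (f : R -> V) : Prop :=
  finite_set (range f) /\ forall v : V, measurable (f @^-1` [set v]).

Definition strongly_measurable V D (f : R -> V) : Prop :=
  exists s : nat -> R -> V,
    (forall n, simple_function (s n)) /\
    {ae mu, forall w, D w -> s n w @[n --> \oo] --> f w}.

Definition integrable_simple V D (f : R -> V) : Prop :=
  simple_function f /\
  forall v : V, v != 0 -> (mu (D `&` f @^-1` [set v]) < +oo)%E.

Definition simple_integral V D (f : R -> V) : V :=
  \sum_(v \in range f) (fine (mu (D `&` f @^-1` [set v])))%:C *: v.

(* "f is Bochner integrable over D and its integral is x".  The function
   nrm (f - s n) need only be Lebesgue (not Borel) measurable; the integral of
   the library is then still the Lebesgue integral, since for nonnegative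
   functions it is a supremum over Borel simple minorants. *)
Definition has_bochner_integral V D (f : R -> V) (x : V) : Prop :=
  exists s : nat -> R -> V,
    [/\ forall n, integrable_simple D (s n),
        {ae mu, forall w, D w -> s n w @[n --> \oo] --> f w},
        (\int[mu]_(w in D) (nrm (f w - s n w))%:E)%E @[n --> \oo] --> 0%E
      & simple_integral D (s n) @[n --> \oo] --> x].

End Integral.

Section Orlicz.
Context {R : realType}.
Local Notation mu := (@lebesgue_measure R).

(* Functions on [0, +oo[ are represented by functions on R whose values at
   negative reals are irrelevant. *)
Definition young_function (Phi : R -> \bar R) : Prop :=
  exists phi : R -> \bar R,
    [/\ (forall s, 0 <= s -> (0 <= phi s)%E) /\
        (forall s t, 0 <= s -> s <= t -> (phi s <= phi t)%E),
        forall t, 0 < t -> phi s @[s --> t^'-] --> phi t,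
        exists2 s, 0 <= s & phi s != 0%E,
        exists2 s, 0 <= s & phi s != +oo%E
      & forall t, 0 <= t -> Phi t = (\int[mu]_(s in `[0%R, t]) phi s)%E].

Definition N_function (Phi : R -> R) : Prop :=
  [/\ young_function (fun t => (Phi t)%:E),
      Phi x / x @[x --> 0^'+] --> (0 : R)
    & x / Phi x @[x --> +oo] --> (0 : R)].

(* L^Phi(J; U) and L^oo(J; U), as sets of functions rather than of classes
   modulo almost everywhere equality. *)
Definition L_Orlicz (U : normedModType R[i]) (Phi : R -> \bar R) (J : set R) :
    set (R -> U) :=
  [set f | strongly_measurable J f /\
     exists2 k : R, 0 < k &
       (\int[mu]_(s in J) Phi (k^-1 * nrm (f s))%R < +oo)%E].

Definition L_infty (U : normedModType R[i]) (J : set R) : set (R -> U) :=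
  [set f | strongly_measurable J f /\
     exists M : R, {ae mu, forall s, J s -> nrm (f s) <= M}].

End Orlicz.

Section Operators.
Context {R : realType}.

Definition bounded_linear (V W : normedModType R[i]) (f : V -> W) : Prop :=
  linear f /\ exists M : R, forall v, nrm (f v) <= M * nrm v.

(* An operator D(A) -> X with D(A) a subset of X; op is meaningful only on
   dom. *)
Record operator (X : Type) := Operator { dom : set X ; op :> X -> X }.

Definition C0_semigroup (X : normedModType R[i]) (T : R -> X -> X) : Prop :=
  [/\ forall t, 0 <= t -> bounded_linear (T t),
      forall x, T 0 x = x,
      forall s t x, 0 <= s -> 0 <= t -> T (s + t) x = T s (T t x)
    & forall x, T t x @[t --> 0^'+] --> x].

Definition generates (X : normedModType R[i]) (A : operator X)
    (T : R -> X -> X) : Prop :=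
  C0_semigroup T /\
  forall x y, (dom A x /\ A x = y) <->
    (h^-1)%:C *: (T h x - x) @[h --> 0^'+] --> y.

(* beta is in the resolvent set of A, and S = (beta - A)^-1. *)
Definition is_resolvent (X : normedModType R[i]) (A : operator X)
    (beta : R[i]) (S : X -> X) : Prop :=
  [/\ bounded_linear S,
      forall x, dom A (S x) /\ beta *: S x - A (S x) = x
    & forall x, dom A x -> S (beta *: x - A x) = x].

(* X1 (through the embedding j) is the completion of X for the norm
   |(beta - A)^-1 x|, for some beta in the resolvent set of A, and T1 is the
   extension of the semigroup T to X1. *)
Definition extrapolation (X : normedModType R[i]) (A : operator X)
    (T : R -> X -> X) (X1 : completeNormedModType R[i]) (j : X -> X1)
    (T1 : R -> X1 -> X1) : Prop :=
  [/\ linear j,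
      exists beta S, is_resolvent A beta S /\ forall x, nrm (j x) = nrm (S x),
      dense (range j)
    & forall t, 0 <= t ->
        bounded_linear (T1 t) /\ forall x, T1 t (j x) = j (T t x)].

(* The set of all Z-admissible B in L(U, X1), where Z J plays the role of
   Z(J; U); "belongs to X" means "belongs to the range of j". *)
Definition admissible (U X X1 : normedModType R[i]) (j : X -> X1)
    (T1 : R -> X1 -> X1) (Z : set R -> set (R -> U)) : set (U -> X1) :=
  [set B | bounded_linear B /\
     forall t0 : R, 0 < t0 -> forall u, Z `]0, t0[%classic u ->
       exists x : X,
         has_bochner_integral `]0, t0[%classic (fun s => T1 (t0 - s) (B (u s))) (j x)].

End Operators.

Section Basis.
Context {R : realType}.

(* The sum of f k over -m <= k < n, where p = (m, n); recall that Negz i is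
   -(i + 1). *)
Definition bilateral_sum (X : normedModType R[i]) (f : int -> X)
    (p : nat * nat) : X :=
  \sum_(i < p.1) f (Negz i) + \sum_(i < p.2) f (Posz i).

(* Convergence of a bilateral series: both bounds tend to infinity
   independently. *)
Definition schauder_basis (X : normedModType R[i]) (phi : int -> X) : Prop :=
  forall x : X, exists! a : int -> R[i],
    bilateral_sum (fun k => a k *: phi k) p
      @[p --> filter_prod \oo \oo] --> x.

Definition riesz_basis (X : normedModType R[i]) (q : R) (phi : int -> X) :
    Prop :=
  schauder_basis phi /\
  exists C1 C2 : R, [/\ 0 < C1, 0 < C2 &
    forall (K : {fset int}) (a : int -> R[i]),
      C1 * (\sum_(k <- K) nrm (a k) `^ q)
        <= nrm (\sum_(k <- K) a k *: phi k) `^ q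
        <= C2 * (\sum_(k <- K) nrm (a k) `^ q)].

Definition generates_diagonal (X : normedModType R[i]) (phi : int -> X)
    (A : operator X) (T : R -> X -> X) : Prop :=
  generates A T /\
  exists lambda : int -> R[i],
    (exists omega : R, forall k, complex.Re (lambda k) <= omega) /\
    forall k,
      (forall t : R, 0 <= t -> T t (phi k) = cexp (lambda k * t%:C) *: phi k) /\
      dom A (phi k) /\ A (phi k) = lambda k *: phi k.

End Basis.

(* Main.v *)
Require Import Defs.
From mathcomp Require Import all_boot all_order all_algebra finmap.
From mathcomp Require Import complex.
From mathcomp Require Import all_classical all_reals all_analysis.
From mathcomp Require Import measurable_realfun.
From mathcomp Require Import ring lra.

(** Essentially bounded controls are steered into X, and one has to find an
    N-function Phi such that controls in L^Phi are steered into X as well.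

    Membership in X is tested by partial sums.  The resolvent is diagonal along
    the basis, so the coefficient functionals extend continuously to the
    extrapolation space, and a point of that space lies in X if and only if the
    partial sums Q M of its expansion converge in X (range_expansion).  Composed
    with the input map, they give linear maps g M from controls to X that are
    continuous for the norm of L^1 and converge on every bounded control.

    The heart of the proof is that such maps are uniformly absolutely continuous:
    g M v is small, uniformly in M, for controls v bounded by one that vanish off
    a set of small measure (uniform_absolute_continuity).  Otherwise a gliding
    hump, in the manner of the Vitali-Hahn-Saks theorem, produces a bounded
    control on which g M does not converge.

    Uniform absolute continuity gives, for each level j, a measure d j such that
    g M v is at most 2^-j / (2 (j + 1)) in norm for all controls v bounded by one
    that live on a set of measure at most d j.  One chooses Phi with Phi (2 j) at
    least j ^ 2 / d j (Nfun).  For a control u with Phi of its norm integrable,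
    Markov's inequality bounds the measure of the set where the norm of u is at
    least 2 j by d j for large j, so the layers of u sum up to a tail that is
    small uniformly in M; hence g M u converges and the input map sends u into X
    (level_sets_cvg).

    The time is reversed so that the integrand T1 s (B (v s)) does not depend on
    the final time t0.  This makes a single Phi serve all t0: the thresholds for
    the horizons 1, 2, 3 and so on are merged along the levels.  Reflection
    invariance of the Lebesgue measure brings back the original formulation.

    Measurability is handled through everywhere limits of step functions
    (step_limit), to which strongly measurable functions reduce up to null sets;
    they are Bochner integrable as soon as their norm is
    (step_limit_bochner). *)

Set Implicit Arguments.
Unset Strict Implicit.
Unset Printing Implicit Defensive.

Import Order.TTheory GRing.Theory Num.Theory.
Import numFieldNormedType.Exports.

Local Open Scope classical_set_scope.
Local Open Scope ring_scope.
Local Open Scope complex_scope.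

(** * Real-valued norms *)

Section Norm.
Context {R : realType}.
Implicit Types V W : normedModType R[i].

Lemma nrmE V (v : V) : `|v| = (nrm v)%:C.
Proof.
rewrite /nrm; have : 0 <= `|v| by [].
by case: (`|v|) => a b; rewrite lecE /= => /andP[/eqP -> _].
Qed.

Lemma nrm_ge0 V (v : V) : 0 <= nrm v.
Proof. by have := normr_ge0 v; rewrite nrmE lecR. Qed.

Lemma nrm0 V : nrm (0 : V) = 0.
Proof. by rewrite /nrm normr0. Qed.

Lemma nrm_eq0 V (v : V) : nrm v = 0 -> v = 0.
Proof. by move=> h; apply/normr0_eq0; rewrite nrmE h. Qed.

Lemma nrmN V (v : V) : nrm (- v) = nrm v.
Proof. by rewrite /nrm normrN. Qed.

Lemma nrmBC V (v w : V) : nrm (v - w) = nrm (w - v).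
Proof. by rewrite -nrmN opprB. Qed.

Lemma nrmD V (v w : V) : nrm (v + w) <= nrm v + nrm w.
Proof. by have := ler_normD v w; rewrite !nrmE -raddfD lecR. Qed.

Lemma nrmB V (v w : V) : nrm (v - w) <= nrm v + nrm w.
Proof. by rewrite -(nrmN w) nrmD. Qed.

Lemma nrm_dist3 V (u v w : V) : nrm (v - w) <= nrm (u - v) + nrm (u - w).
Proof. by rewrite (nrmBC u v) -[v - w](subrKA u) nrmD. Qed.

Lemma nrm_leD V (v w : V) : nrm v <= nrm w + nrm (v - w).
Proof. by rewrite -{1}[v](subrKC w) nrmD. Qed.

Lemma nrmZ V (a : R[i]) (v : V) : nrm (a *: v) = nrm a * nrm v.
Proof. by apply: complexI; rewrite -nrmE normrZ !nrmE rmorphM. Qed.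

Lemma nrmM (a b : R[i]) : nrm (a * b) = nrm a * nrm b.
Proof. by apply: complexI; rewrite -nrmE normrM !nrmE rmorphM. Qed.

Lemma nrmR (r : R) : nrm r%:C = `|r|.
Proof. by apply: complexI; rewrite -nrmE normc_def /= expr0n addr0 sqrtr_sqr. Qed.

Lemma nrm_sum V I (r : seq I) (P : pred I) (F : I -> V) :
  nrm (\sum_(i <- r | P i) F i) <= \sum_(i <- r | P i) nrm (F i).
Proof.
elim/big_ind2 : _ => [|x a y b xa yb|//]; first by rewrite nrm0.
by rewrite (le_trans (nrmD _ _))// lerD.
Qed.

Lemma cvg_nrmP V {I} (F : set_system I) {FF : Filter F} (f : I -> V) (l : V) :
  (f x @[x --> F] --> l) <->
  forall e : R, 0 < e -> \forall x \near F, nrm (l - f x) < e.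
Proof.
split=> [/cvgrPdist_lt h e e0|h].
  have := h e%:C; rewrite ltcR => /(_ e0).
  by apply: filterS => x; rewrite nrmE ltcR.
apply/cvgrPdist_lt => -[a b]; rewrite ltcE /= => /andP[/eqP -> a0].
have := h a a0; rewrite -[_ +i* 0]/(a%:C).
by apply: filterS => x; rewrite nrmE ltcR.
Qed.

Lemma cvg_nrm V {I} (F : set_system I) {FF : Filter F} (f : I -> V) (l : V) :
  f x @[x --> F] --> l -> nrm (f x) @[x --> F] --> nrm l.
Proof.
move=> /cvg_nrmP h; apply/cvgrPdist_lt => e /h.
apply: filterS => x; apply: le_lt_trans.
have h1 := nrm_leD l (f x); have := nrm_leD (f x) l; rewrite nrmBC => h2.
by rewrite ler_norml; lra.
Qed.

End Norm.

(** * Bounded linear maps and dense embeddings *)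

Section BoundedLinear.
Context {R : realType}.
Implicit Types V W : normedModType R[i].

Lemma map0_linear V W (f : V -> W) : linear f -> f 0 = 0.
Proof.
by move=> h; have := h (- 1) 0 0; rewrite !scaleN1r !addNr.
Qed.

Lemma mapD_linear V W (f : V -> W) : linear f -> {morph f : x y / x + y}.
Proof. by move=> h x y; have := h 1 x y; rewrite !scale1r. Qed.

Lemma mapZ_linear V W (f : V -> W) a : linear f -> {morph f : x / a *: x}.
Proof. by move=> h x; have := h a x 0; rewrite (map0_linear h) !addr0. Qed.

Lemma mapB_linear V W (f : V -> W) : linear f -> {morph f : x y / x - y}.
Proof.
move=> h x y; rewrite (mapD_linear h); congr (_ + _).
by rewrite -scaleN1r (mapZ_linear _ h) scaleN1r.
Qed.

Lemma map_sum_linear V W (f : V -> W) I (r : seq I) (F : I -> V) : linear f ->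
  f (\sum_(i <- r) F i) = \sum_(i <- r) f (F i).
Proof.
by move=> h; apply: (big_morph f (mapD_linear h) (map0_linear h)).
Qed.

Lemma bounded_linear_ge0 V W (f : V -> W) : bounded_linear f ->
  exists2 M : R, 0 <= M & forall v, nrm (f v) <= M * nrm v.
Proof.
move=> [lf [M hM]]; exists `|M| => // v.
by rewrite (le_trans (hM v))// ler_wpM2r ?nrm_ge0// ler_norm.
Qed.

Lemma bounded_linear_cvg V W (f : V -> W) I (F : set_system I) {FF : Filter F}
    (u : I -> V) (l : V) : bounded_linear f ->
  u x @[x --> F] --> l -> f (u x) @[x --> F] --> f l.
Proof.
move=> bf /cvg_nrmP h; have [M M0 hM] := bounded_linear_ge0 bf.
apply/cvg_nrmP => e e0; have := h (e / (M + 1)).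
rewrite divr_gt0// ?ltr_wpDl// => /(_ isT); apply: filterS => x.
rewrite ltr_pdivlMr ?ltr_wpDl// => hx.
rewrite -(mapB_linear bf.1) (le_lt_trans (hM _))// (le_lt_trans _ hx)// mulrC.
by rewrite ler_wpM2l ?nrm_ge0// lerDl.
Qed.

Lemma cauchy_nrm_cvg (V : completeNormedModType R[i]) (u : nat -> V) :
  (forall e : R, 0 < e -> exists N, forall n m, (N <= n)%N -> (N <= m)%N ->
    nrm (u n - u m) < e) ->
  exists l : V, u n @[n --> \oo] --> l.
Proof.
move=> h; suff hl : cvg (u n @[n --> \oo]) by exists (lim (u n @[n --> \oo])).
apply/cauchy_cvgP/cauchy_ballP => -[a b]; rewrite ltcE /= => /andP[/eqP -> a0].
have [N hN] := h _ a0.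
exists ([set u n | n in [set n | (N <= n)%N]], [set u n | n in [set n | (N <= n)%N]]).
  by split; exists N => // n Nn; exists n.
move=> [x y] [] /= [n Nn <-] [m Nm <-]; rewrite -ball_normE /ball_/=.
by rewrite -[_ +i* 0]/(a%:C) nrmE ltcR hN.
Qed.

Lemma cvg_cauchy_nrm (V : normedModType R[i]) (u : nat -> V) (l : V) :
  u n @[n --> \oo] --> l ->
  forall e : R, 0 < e -> exists N, forall n m, (N <= n)%N -> (N <= m)%N ->
    nrm (u n - u m) < e.
Proof.
move=> /cvg_nrmP h e e0; have [|N _ hN] := h (e / 2); first by rewrite divr_gt0.
exists N => n m Nn Nm; rewrite (le_lt_trans (nrm_dist3 l _ _))//.
by rewrite [e]splitr ltrD// hN.
Qed.

Lemma dense_rangeP V W (j : V -> W) : dense (range j) ->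
  forall y (e : R), 0 < e -> exists x, nrm (y - j x) < e.
Proof.
move=> dj y e e0; have e0' : 0 < e%:C by rewrite ltcR.
have [|//|z [hz [x _ xz]]] := dj (ball y e%:C)°.
- by exists y; apply: nbhsx_ballx.
- exact: open_interior.
- exists x; have := interior_subset hz; rewrite -xz -ball_normE /ball_/=.
  by rewrite nrmE ltcR.
Qed.

Lemma dense_bound V W W' (j : V -> W) (f : W -> W') (M : R) : dense (range j) ->
  bounded_linear f -> (forall x, nrm (f (j x)) <= M * nrm (j x)) ->
  forall y, nrm (f y) <= M * nrm y.
Proof.
move=> dj bf h y.
have [N N0 hN] := bounded_linear_ge0 bf.
apply/ler_addgt0Pr => e e0.
pose d := e / (N + `|M| + 1).
have d0 : 0 < d by rewrite divr_gt0// ltr_wpDl// addr_ge0.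
have [x hx] := dense_rangeP dj y d0.
have -> : f y = f (j x) + f (y - j x) by rewrite -(mapD_linear bf.1) subrKC.
rewrite (le_trans (nrmD _ _))//.
have h1 : nrm (j x) <= nrm y + nrm (y - j x) by rewrite nrmBC nrm_leD.
have h2 : nrm y <= nrm (j x) + nrm (y - j x) by rewrite nrm_leD.
have h3 : M * nrm (j x) <= M * nrm y + `|M| * nrm (y - j x).
  rewrite -lerBlDl -mulrBr (le_trans (ler_norm _))// normrM ler_wpM2l//.
  by rewrite ler_norml; lra.
have h4 : (N + `|M| + 1) * nrm (y - j x) <= e.
  by rewrite mulrC -ler_pdivlMr ?ltW// ltr_wpDl// addr_ge0.
have := h x; have := hN (y - j x); have := nrm_ge0 (y - j x); lra.
Qed.

Lemma dense_eq V W W' (j : V -> W) (f g : W -> W') : dense (range j) ->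
  bounded_linear f -> bounded_linear g -> (forall x, f (j x) = g (j x)) ->
  forall y, f y = g y.
Proof.
move=> dj bf bg h y; apply/eqP; rewrite -subr_eq0; apply/eqP/nrm_eq0/eqP.
rewrite eq_le nrm_ge0 andbT -[leRHS](mul0r (nrm y)).
apply: (dense_bound (f := fun z => f z - g z) dj) => [|x].
  split=> [a u v|].
    by rewrite bf.1 bg.1 opprD addrACA scalerBr.
  have [M hM] := bf.2; have [N hN] := bg.2; exists (M + N) => v.
  by rewrite (le_trans (nrmB _ _))// mulrDl lerD.
by rewrite h subrr nrm0 mul0r.
Qed.

(** A linear map that is isometric for the norm transported by a dense
    embedding extends to an isometry: the closure of its graph is again the
    graph of a linear isometry. *)
Lemma extension_dense (X : completeNormedModType R[i]) V W (j : V -> W)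
    (S : V -> X) : linear j -> linear S -> dense (range j) ->
  (forall x, nrm (j x) = nrm (S x)) ->
  exists S1 : W -> X, [/\ bounded_linear S1, forall x, S1 (j x) = S x
    & forall y, nrm (S1 y) = nrm y].
Proof.
move=> lj lS dj jS.
(* (y, w) is in the closure of the set of all pairs (j x, S x) *)
pose rel y w := forall e : R, 0 < e -> exists2 x, nrm (y - j x) < e & nrm (w - S x) < e.
have ex y : exists w, rel y w.
  have /choice[x hx] n : exists x, nrm (y - j x) < (n.+1%:R)^-1.
    by apply: (dense_rangeP dj); rewrite invr_gt0.
  have small (e : R) : 0 < e -> exists N, forall n, (N <= n)%N -> nrm (y - j (x n)) < e.
    move=> e0; have /cvgrPdist_lt/(_ _ e0)[N _ hN] := @cvg_harmonic R.
    exists N => n /hN; rewrite sub0r normrN ger0_norm ?harmonic_ge0//.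
    by apply: lt_trans; exact: hx.
  have [|w hw] := @cauchy_nrm_cvg X (S \o x).
    move=> e e0; have [|N hN] := small (e / 2); first by rewrite divr_gt0.
    exists N => n m Nn Nm /=; rewrite -(mapB_linear lS) -jS (mapB_linear lj).
    by rewrite (le_lt_trans (nrm_dist3 y _ _))// [e]splitr ltrD// hN.
  exists w => e e0; have [N hN] := small _ e0.
  have /cvg_nrmP/(_ _ e0)[N' _ hN'] := hw.
  by exists (x (maxn N N')); [apply: hN|apply: hN']; rewrite ?leq_maxl//= leq_maxr.
have iso y w : rel y w -> nrm w = nrm y.
  move=> h; apply/eqP; rewrite eq_le.
  by apply/andP; split; apply/ler_addgt0Pr => e e0;
    (have [|x h1 h2] := h (e / 2); first by rewrite divr_gt0);
    have := nrm_leD y (j x); have := nrm_leD (j x) y;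
    have := nrm_leD w (S x); have := nrm_leD (S x) w;
    rewrite jS (nrmBC (S x)) -jS (nrmBC (j x)) jS; lra.
have lin a y w y' w' : rel y w -> rel y' w' -> rel (a *: y + y') (a *: w + w').
  move=> h h' e e0; have d0 : 0 < e / (nrm a + 1).
    by rewrite divr_gt0// ltr_wpDl ?nrm_ge0.
  have [x h1 h2] := h _ d0; have [x' h1' h2'] := h' _ d0.
  have aux p p' : p < e / (nrm a + 1) -> p' < e / (nrm a + 1) -> nrm a * p + p' < e.
    rewrite !ltr_pdivlMr ?ltr_wpDl ?nrm_ge0// => hp hp'.
    by have := nrm_ge0 a; nra.
  exists (a *: x + x'); rewrite ?lj ?lS opprD addrACA -scalerBr.
    by rewrite (le_lt_trans (nrmD _ _))// nrmZ aux.
  by rewrite (le_lt_trans (nrmD _ _))// nrmZ aux.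
have uniq y w w' : rel y w -> rel y w' -> w = w'.
  move=> h h'; have := iso _ _ (lin (- 1) _ _ _ _ h h').
  rewrite !scaleN1r addNr nrm0 => /nrm_eq0/eqP; rewrite addrC subr_eq0.
  by move/eqP.
have /choice[S1 hS1] := ex; exists S1; split.
- split=> [a u v|]; first by apply: uniq (hS1 _) _; exact: lin.
  by exists 1 => v; rewrite mul1r (iso v).
- move=> x; apply: uniq (hS1 _) _ => e e0; exists x; by rewrite subrr nrm0.
- by move=> y; exact: iso.
Qed.

End BoundedLinear.

(** * Coefficients along a Riesz basis *)

Lemma powR_mul_le {R : realType} (q c a b : R) : 0 < q -> 0 < c -> 0 <= a -> 0 <= b ->
  c * a `^ q <= b `^ q -> a <= (c^-1) `^ (q^-1) * b.
Proof.
move=> q0 c0 a0 b0 h; rewrite leNgt; apply/negP => hlt.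
have g0 : 0 <= (c^-1) `^ (q^-1) * b by rewrite mulr_ge0// powR_ge0.
have := gt0_ltr_powR q0 g0 a0 hlt.
rewrite powRM// ?powR_ge0// -powRrM mulVf ?gt_eqF// powRr1 ?invr_ge0 ?ltW//.
by rewrite ltNge -ler_pdivrMl ?invr_gt0// invrK h.
Qed.

Section Basis.
Context {R : realType} (X : completeNormedModType R[i]) (q : R) (phi : int -> X).
Hypotheses (q0 : 0 < q) (rb : riesz_basis q phi).

Let sb : schauder_basis phi := rb.1.

(** The integers k with -m <= k < n, where p = (m, n). *)
Definition bilateral_index (p : nat * nat) : seq int :=
  [seq Negz i | i <- iota 0 p.1] ++ [seq Posz i | i <- iota 0 p.2].

Lemma bilateral_sumE (V : normedModType R[i]) (f : int -> V) p :
  bilateral_sum f p = \sum_(k <- bilateral_index p) f k.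
Proof.
rewrite /bilateral_sum big_cat/= !big_map.
rewrite -(big_mkord xpredT (fun i => f (Negz i))).
by rewrite -(big_mkord xpredT (fun i => f (Posz i))) /index_iota !subn0.
Qed.

Lemma bilateral_index_uniq p : uniq (bilateral_index p).
Proof.
rewrite cat_uniq !map_inj_uniq ?iota_uniq; try by move=> ? ? [].
by rewrite andbT; apply/hasPn => x /mapP[i _ ->]; apply/negP => /mapP[].
Qed.

Lemma mem_bilateral_index_ltn (k : int) m n : (`|k| < m)%N -> (`|k| < n)%N ->
  k \in bilateral_index (m, n).
Proof.
move=> hm hn; rewrite mem_cat; case: k hm hn => k /= hm hn.
  by rewrite [X in _ || X]map_f ?orbT// mem_iota.
by rewrite map_f// mem_iota /= (leq_trans _ hm).
Qed.

Lemma mem_bilateral_index (k : int) : \forall p \near filter_prod \oo \oo,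
  k \in bilateral_index p.
Proof.
exists ([set n | (`|k| < n)%N], [set n | (`|k| < n)%N]).
  by split; exists `|k|.+1.
by move=> [m n] /= [hm hn]; exact: mem_bilateral_index_ltn.
Qed.

Lemma big_bilateral_fset (V : nmodType) (f : int -> V) p :
  \sum_(k <- [fset k in bilateral_index p]%fset) f k
  = \sum_(k <- bilateral_index p) f k.
Proof.
apply: perm_big; apply: uniq_perm => [||k].
- exact: fset_uniq.
- exact: bilateral_index_uniq.
- by rewrite in_fset.
Qed.

(** The coefficients of a vector along the basis. *)
Definition coef (x : X) : int -> R[i] := projT1 (cid (sb x)).

Local Notation psum a p := (bilateral_sum (fun k => a k *: phi k) p).

Lemma coefP x : psum (coef x) p @[p --> filter_prod \oo \oo] --> x.
Proof. by rewrite /coef; case: cid => a []. Qed.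

Lemma coef_unique x a : psum a p @[p --> filter_prod \oo \oo] --> x ->
  a = coef x.
Proof. by rewrite /coef; case: cid => b [_ hb] h /=; rewrite (hb a h). Qed.

Lemma coef_inj x y : (forall k, coef x k = coef y k) -> x = y.
Proof.
move=> /funext h; have := @coefP x; rewrite h => hx.
exact: cvg_unique hx (@coefP y).
Qed.

Lemma coef_linear c x y k : coef (c *: x + y) k = c * coef x k + coef y k.
Proof.
have : (fun k => c * coef x k + coef y k) = coef (c *: x + y).
  apply: coef_unique.
  rewrite (_ : (fun p => _) = (fun p => c *: psum (coef x) p + psum (coef y) p)).
    by apply: cvgD; [apply: cvgZr|]; exact: coefP.
  apply/funext => p; rewrite !bilateral_sumE scaler_sumr -big_split/=.
  by apply: eq_bigr => i _; rewrite scalerDl scalerA.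
by move=> <-.
Qed.

Lemma coef_phi l k : coef (phi l) k = (k == l)%:R.
Proof.
have : (fun k => (k == l)%:R) = coef (phi l).
  apply: coef_unique; apply: cvg_near_cst.
  apply: filterS (mem_bilateral_index l) => p lp.
  rewrite bilateral_sumE (bigD1_seq l)//= ?bilateral_index_uniq//.
  rewrite eqxx scale1r big1 ?addr0// => i /negPf ->.
  by rewrite scale0r.
by move=> <-.
Qed.

Lemma coef_psum a p k : k \in bilateral_index p -> coef (psum a p) k = a k.
Proof.
move=> kp; rewrite bilateral_sumE.
have coefD x y : coef (x + y) k = coef x k + coef y k.
  by rewrite -[x]scale1r coef_linear mul1r scale1r.
have coef0 : coef 0 k = 0 by apply: (addrI (coef 0 k)); rewrite -coefD !addr0.
rewrite (big_morph (fun x => coef x k) coefD coef0).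
rewrite (bigD1_seq k)//= ?bilateral_index_uniq// big1 ?addr0 => [|i ik].
  by rewrite -[a k *: _]addr0 coef_linear coef0 coef_phi eqxx mulr1 addr0.
by rewrite -[a i *: _]addr0 coef_linear coef0 coef_phi eq_sym (negPf ik) mulr0 addr0.
Qed.

Lemma riesz_bounds : exists C1 C2 : R, [/\ 0 < C1, 0 < C2 & forall a p,
  C1 * (\sum_(k <- bilateral_index p) nrm (a k) `^ q) <= nrm (psum a p) `^ q
    <= C2 * (\sum_(k <- bilateral_index p) nrm (a k) `^ q)].
Proof.
have [C1 [C2 [c1 c2 h]]] := rb.2; exists C1, C2; split=> // a p.
by have := h [fset k in bilateral_index p]%fset a; rewrite !big_bilateral_fset bilateral_sumE.
Qed.

(** The lower Riesz bound makes the coefficient functionals bounded, even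
    uniformly in the index. *)
Lemma coef_bounded : exists2 C : R, 0 <= C & forall x k, nrm (coef x k) <= C * nrm x.
Proof.
have [C1 [C2 [c1 c2 h]]] := riesz_bounds.
exists ((C1^-1) `^ (q^-1)); first exact: powR_ge0.
move=> x k.
have hc : (C1^-1) `^ (q^-1) * nrm (psum (coef x) p) @[p --> filter_prod \oo \oo]
    --> (C1^-1) `^ (q^-1) * nrm x.
  by apply: cvgMr; apply: cvg_nrm; exact: coefP.
apply: (ler_cvg_to (cvg_cst _) hc).
apply: filterS (mem_bilateral_index k) => p kp.
apply: powR_mul_le => //; rewrite ?nrm_ge0//.
have /andP[+ _] := h (coef x) p; apply: le_trans.
rewrite ler_pM2l// (big_rem k)//= lerDl sumr_ge0// => i _.
exact: powR_ge0.
Qed.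

Lemma phi_neq0 k : phi k != 0.
Proof.
have [C1 [C2 [c1 _ h]]] := rb.2.
have /andP[+ _] := h [fset k]%fset (fun=> 1); rewrite !big_seq_fset1 scale1r.
apply: contraTneq => ->; rewrite nrm0 powR0 ?gt_eqF// -ltNge.
by rewrite -[1]/(1%:C) nrmR normr1 powR1 mulr1.
Qed.

Section Diagonal.
Variables (L : X -> X) (m : int -> R[i]).
Hypotheses (bL : bounded_linear L) (hL : forall k, L (phi k) = m k *: phi k).

Lemma diagonal_psum a p : L (psum a p) = psum (fun k => m k * a k) p.
Proof.
rewrite !bilateral_sumE (map_sum_linear _ _ bL.1).
by apply: eq_bigr => k _; rewrite (mapZ_linear _ bL.1) hL scalerA mulrC.
Qed.

Lemma coef_diagonal x k : coef (L x) k = m k * coef x k.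
Proof.
have : (fun k => m k * coef x k) = coef (L x).
  apply: coef_unique.
  rewrite (_ : (fun p => _) = (fun p => L (psum (coef x) p))).
    by apply: (bounded_linear_cvg bL); exact: coefP.
  by apply/funext => p; rewrite diagonal_psum.
by move=> <-.
Qed.

End Diagonal.

(** An operator that is diagonal along the basis is bounded by a bound of its
    eigenvalues, up to a factor that depends on the basis only. *)
Lemma diagonal_norm_bound : exists2 C : R, 0 <= C &
  forall (L : X -> X) m (M : R), bounded_linear L ->
    (forall k, L (phi k) = m k *: phi k) ->
    (forall k, nrm (m k) <= M) -> forall x, nrm (L x) <= C * M * nrm x.
Proof.
have [C1 [C2 [c1 c2 h]]] := riesz_bounds.
pose C := ((C1 / C2)^-1) `^ (q^-1).
exists C => [|L m M bL hL hm x]; first exact: powR_ge0.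
have M0 : 0 <= M by rewrite (le_trans _ (hm 0))// nrm_ge0.
have hc : C * M * nrm (psum (coef x) p) @[p --> filter_prod \oo \oo]
    --> C * M * nrm x.
  by apply: cvgMr; apply: cvg_nrm; exact: coefP.
have hl : nrm (L (psum (coef x) p)) @[p --> filter_prod \oo \oo] --> nrm (L x).
  by apply: cvg_nrm; apply: (bounded_linear_cvg bL); exact: coefP.
apply: (ler_cvg_to hl hc); apply: nearW => p.
rewrite -mulrA; apply: powR_mul_le => //; rewrite ?divr_gt0 ?nrm_ge0 ?mulr_ge0 ?nrm_ge0//.
have /andP[h1 _] := h (coef x) p.
have /andP[_ h2] := h (fun k => m k * coef x k) p.
rewrite (diagonal_psum bL hL) powRM ?nrm_ge0//.
rewrite mulrAC ler_pdivrMr// (le_trans (ler_wpM2l (ltW c1) h2))//.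
rewrite mulrCA mulrC ler_pM2r//.
rewrite (le_trans _ (ler_wpM2l (powR_ge0 M q) h1))//.
rewrite mulrCA ler_pM2l// mulr_sumr; apply: ler_sum => k _.
by rewrite nrmM powRM ?nrm_ge0// ler_wpM2r ?powR_ge0// ge0_ler_powR ?nnegrE ?nrm_ge0// ltW.
Qed.

End Basis.

(** * The extrapolated semigroup *)

Lemma nrm_cexp {R : realType} (z : R[i]) : nrm (cexp z) = expR (complex.Re z).
Proof.
rewrite /cexp nrmM nrmR ger0_norm ?expR_ge0//.
by rewrite /nrm normc_def /= cos2Dsin2 sqrtr1 mulr1.
Qed.

Section Extrapolation.
Context {R : realType} (q : R) (X : completeNormedModType R[i])
  (phi : int -> X) (A : operator X) (T : R -> X -> X)
  (X1 : completeNormedModType R[i]) (j : X -> X1) (T1 : R -> X1 -> X1).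
Hypotheses (q0 : 0 < q) (rb : riesz_basis q phi)
  (gd : generates_diagonal phi A T) (ex : extrapolation A T j T1).

Local Notation coef := (coef rb).

(** The resolvent is diagonal; m k is beta minus the k-th eigenvalue. *)
Lemma resolvent_diagonal beta S : is_resolvent A beta S ->
  exists m : int -> R[i], (forall k, m k != 0) /\
    forall k, S (phi k) = (m k)^-1 *: phi k.
Proof.
move=> [bS _ hS]; have [_ [lambda [_ hl]]] := gd.
exists (fun k => beta - lambda k).
have eqS k : (beta - lambda k) *: S (phi k) = phi k.
  have [_ [dk Ak]] := hl k.
  by rewrite -{2}[phi k](hS _ dk) Ak -scalerBl (mapZ_linear _ bS.1).
have m0 k : beta - lambda k != 0.
  apply/eqP => h; have := eqS k; rewrite h scale0r => /esym/eqP.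
  by apply/negP/(phi_neq0 q0 rb).
by split=> // k; rewrite -{2}[phi k]eqS scalerK.
Qed.

(** Local boundedness of the semigroup, read off its eigenvalues. *)
Lemma semigroup_bound (N : R) : exists2 M : R, 0 <= M &
  forall t x, 0 <= t -> t <= N -> nrm (T t x) <= M * nrm x.
Proof.
have [[[bT _ _ _] _] [lambda [[omega ho] hl]]] := gd.
have [C C0 hC] := diagonal_norm_bound q0 rb.
exists (C * expR (`|omega| * `|N|)) => [|t x t0 tN]; first by rewrite mulr_ge0// expR_ge0.
apply: (hC (T t) (fun k => cexp (lambda k * t%:C))) => [|k|k].
- exact: bT.
- by have [] := hl k; move=> /(_ t t0).
- rewrite nrm_cexp ler_expR.
  rewrite (_ : complex.Re _ = complex.Re (lambda k) * t); last first.
    by case: (lambda k) => a b /=; rewrite mulr0 subr0.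
  have ho' : complex.Re (lambda k) <= `|omega| by rewrite (le_trans (ho k))// ler_norm.
  rewrite (le_trans (ler_wpM2r t0 ho'))// ler_wpM2l// (le_trans tN)//.
  exact: ler_norm.
Qed.

Lemma resolvent_semigroup_comm beta S : is_resolvent A beta S ->
  forall t x, 0 <= t -> S (T t x) = T t (S x).
Proof.
move=> rS t x t0; have [m [_ hm]] := resolvent_diagonal rS.
have [[[bT _ _ _] _] [lambda [_ hl]]] := gd.
have hT k : T t (phi k) = cexp (lambda k * t%:C) *: phi k.
  by have [] := hl k; move=> /(_ t t0).
have [bS _ _] := rS.
apply: (coef_inj (rb := rb)) => k.
rewrite (coef_diagonal rb bS hm) (coef_diagonal rb (bT _ t0) hT).
by rewrite (coef_diagonal rb (bT _ t0) hT) (coef_diagonal rb bS hm) mulrCA.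
Qed.

(** The extrapolated norm of x is the norm of S x, where the resolvent S
    commutes with the semigroup, so the bounds of T carry over to T1. *)
Lemma extrapolation_bound (N : R) : exists2 M : R, 0 <= M &
  forall t y, 0 <= t -> t <= N -> nrm (T1 t y) <= M * nrm y.
Proof.
have [lj [beta [S [rS jS]]] dj hT1] := ex.
have [M M0 hM] := semigroup_bound N; exists M => // t y t0 tN.
have [bT1 T1j] := hT1 t t0.
apply: (dense_bound dj bT1) => x.
by rewrite T1j !jS (resolvent_semigroup_comm rS)// hM.
Qed.

Lemma extrapolation_T0 y : T1 0 y = y.
Proof.
have [lj _ dj hT1] := ex; have [bT1 T1j] := hT1 0 (lexx _).
have [[[_ T0 _ _] _] _] := gd.
apply: (dense_eq dj bT1 _ _ y) => [|x]; last by rewrite T1j T0.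
by split=> //; exists 1 => v; rewrite mul1r.
Qed.

Lemma extrapolation_TD s t y : 0 <= s -> 0 <= t ->
  T1 (s + t) y = T1 s (T1 t y).
Proof.
move=> s0 t0; have [lj _ dj hT1] := ex.
have [bs js] := hT1 s s0; have [bt jt] := hT1 t t0.
have [bst jst] := hT1 (s + t) (addr_ge0 s0 t0).
have [[[_ _ TD _] _] _] := gd.
apply: (dense_eq (g := fun z => T1 s (T1 t z)) dj bst _ _ y) => [|x].
  split=> [a u v|]; first by rewrite bt.1 bs.1.
  have [M M0 hM] := bounded_linear_ge0 bs.
  have [M' M'0 hM'] := bounded_linear_ge0 bt.
  exists (M * M') => v; rewrite (le_trans (hM _))// -mulrA.
  by rewrite ler_wpM2l.
by rewrite jst jt js TD.
Qed.

(** Strong continuity at 0, from the dense range of j and local boundedness. *)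
Lemma extrapolation_continuous0 y (e : R) : 0 < e -> exists2 d : R, 0 < d &
  forall h, 0 <= h -> h < d -> nrm (T1 h y - y) < e.
Proof.
move=> e0; have [lj [beta [S [rS jS]]] dj hT1] := ex.
have [bS _ _] := rS; have [L L0 hL] := bounded_linear_ge0 bS.
have [[[_ _ _ Tc] _] _] := gd.
have [M M0 hM] := extrapolation_bound 1.
have MM : 0 < 2 * (M + 1) by lra.
have [x hx] := dense_rangeP dj y (divr_gt0 e0 MM).
have e1 : 0 < e / (2 * (L + 1)) by rewrite divr_gt0//; lra.
have /cvg_nrmP/(_ _ e1) := Tc x.
move=> /nbhs_ballP[d /= d0 hd].
exists (Num.min d 1) => [|h h0]; first by rewrite lt_min d0 ltr01.
rewrite lt_min => /andP[hd' h1].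
have [->|hn0] := eqVneq h 0; first by rewrite extrapolation_T0 subrr nrm0.
have hp : 0 < h by rewrite lt_def hn0.
have hTx : nrm (x - T h x) < e / (2 * (L + 1)).
  by apply: hd => //; rewrite /ball/= sub0r normrN ger0_norm.
have [bT1 T1j] := hT1 h h0.
have -> : T1 h y - y = T1 h (y - j x) + ((T1 h (j x) - j x) + (j x - y)).
  by rewrite (mapB_linear bT1.1) addrA subrKA subrKA.
have b1 := hM h (y - j x) h0 (ltW h1).
have b2 : nrm (T1 h (j x) - j x) <= L * nrm (x - T h x).
  by rewrite T1j -(mapB_linear lj) jS nrmBC (le_trans (hL _))// nrmBC.
rewrite (le_lt_trans (nrmD _ _))// (le_lt_trans (lerD (lexx _) (nrmD _ _)))//.
rewrite (nrmBC (j x)).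
move: hx hTx; rewrite !ltr_pdivlMr//; last by lra.
have := nrm_ge0 (y - j x); have := nrm_ge0 (x - T h x); lra.
Qed.

(** Q M y is the M-th symmetric partial sum of the expansion of y along the
    basis, whose coefficients make sense on the whole extrapolation space: y
    comes from X exactly when this expansion converges in X. *)
Lemma range_expansion : exists Q : nat -> X1 -> X,
  (forall M, bounded_linear (Q M)) /\
  forall y, (exists x, j x = y) <-> exists x : X, Q M y @[M --> \oo] --> x.
Proof.
have [lj [beta [S [rS jS]]] dj hT1] := ex.
have [bS _ _] := rS.
have [m [m0 hm]] := resolvent_diagonal rS.
have [S1 [bS1 S1j iS1]] := extension_dense lj bS.1 dj jS.
(* S divides the k-th coefficient by m k, so c k extends the k-th coefficient
   from X to X1. *)
pose c k y := m k * coef (S1 y) k.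
have cj k x : c k (j x) = coef x k.
  by rewrite /c S1j (coef_diagonal rb bS hm) mulrA divff ?mul1r.
have [K K0 hK] := coef_bounded q0 rb.
pose Q M y := bilateral_sum (fun k => c k y *: phi k) (M, M).
have bQ M : bounded_linear (Q M).
  split=> [a u v|].
    rewrite /Q !bilateral_sumE scaler_sumr -big_split/=.
    apply: eq_bigr => k _; rewrite scalerA -scalerDl; congr (_ *: _).
    by rewrite /c bS1.1 coef_linear; ring.
  exists (\sum_(k <- bilateral_index (M, M)) nrm (m k) * K * nrm (phi k)) => v.
  rewrite /Q bilateral_sumE (le_trans (nrm_sum _ _ _))// mulr_suml.
  apply: ler_sum => k _; rewrite nrmZ /c nrmM.
  have := hK (S1 v) k; rewrite iS1 => hv.
  have this := ler_wpM2r (nrm_ge0 (phi k)) (ler_wpM2l (nrm_ge0 (m k)) hv).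
  apply: (le_trans this); rewrite le_eqVlt; apply/orP; left; apply/eqP; ring.
exists Q; split=> // y; split=> [[x <-]|[x hx]].
  exists x; rewrite (_ : (fun M => _) =
      (fun p => bilateral_sum (fun k => coef x k *: phi k) p) \o (fun M => (M, M))).
    apply: (@cvg_comp _ _ _ _ _ _ (filter_prod \oo \oo)); last exact: coefP.
    move=> P [[U V] [[a _ ha] [b _ hb]] hUV]; exists (maxn a b) => // M hM.
    by apply: hUV; split; [apply: ha|apply: hb];
      rewrite /= (leq_trans _ hM)// ?leq_maxl ?leq_maxr.
  by apply/funext => M; rewrite /Q /=; under eq_fun do rewrite cj.
exists x.
have cx k : coef x k = c k y.
  have h1 : coef (Q M y) k @[M --> \oo] --> coef x k.
    apply: (bounded_linear_cvg (f := fun x => coef x k : R[i])) hx.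
    split=> [a u v|]; first by rewrite coef_linear.
    by exists K => v; exact: hK.
  have h2 : coef (Q M y) k @[M --> \oo] --> c k y.
    apply: cvg_near_cst; exists `|k|.+1 => // M /= kM.
    rewrite /Q coef_psum// mem_bilateral_index_ltn//=.
  exact: cvg_unique h1 h2.
suff : S1 (j x - y) = 0.
  move=> h; have := iS1 (j x - y); rewrite h nrm0 => /esym/nrm_eq0/eqP.
  by rewrite subr_eq0 => /eqP.
rewrite (mapB_linear bS1.1); apply/eqP; rewrite subr_eq0; apply/eqP.
apply: (coef_inj (rb := rb)) => k; apply: (mulfI (m0 k)).
by rewrite -!/(c k _) cj cx.
Qed.

End Extrapolation.

(** * Step functions and their pointwise limits *)

Section Step.
Context {R : realType}.
Local Notation mu := (@lebesgue_measure R).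

(** Functions with finitely many values, each taken on a Borel set.  The values
    lie in an arbitrary type, so that pairs of step functions, or step functions
    valued in bool or nat, are step functions; for a normed module this is
    simple_function. *)
Definition step (W : Type) (f : R -> W) : Prop :=
  finite_set (range f) /\ forall w : W, measurable (f @^-1` [set w]).

Lemma step_cst (W : Type) (w : W) : step (fun=> w).
Proof.
split=> [|v]; first by apply: sub_finite_set (finite_set1 w) => _ [? _ <-].
have [->|vw] := EM (v = w).
  by rewrite (_ : _ @^-1` _ = setT)//; apply/seteqP; split.
by rewrite (_ : _ @^-1` _ = set0)//; apply/seteqP; split=> // x /= /esym.
Qed.

Lemma step_measurable (W : Type) (f : R -> W) (Y : set W) : step f ->
  measurable (f @^-1` Y).
Proof.
move=> [ff mf].
rewrite (_ : _ @^-1` _ = \bigcup_(w in range f `&` Y) (f @^-1` [set w])).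
  by apply: fin_bigcup_measurable => [|w _]; [exact: finite_setIl|exact: mf].
apply/seteqP; split=> [x Yx|x [w [_ Yw]] /= ->//].
by exists (f x) => //; split=> //; exists x.
Qed.

(** Gluing of step functions f w along the finite partition into fibres of k. *)
Lemma step_glue (W Z : Type) (k : R -> W) (f : W -> R -> Z) :
  step k -> (forall w, step (f w)) -> step (fun x => f (k x) x).
Proof.
move=> sk sf; split=> [|z].
  apply: (@sub_finite_set _ _ (\bigcup_(w in range k) range (f w))).
    by move=> _ [x _ <-]; exists (k x); exists x.
  by apply: bigcup_finite => [|w _]; [exact: sk.1|exact: (sf w).1].
rewrite (_ : _ @^-1` _ =
    \bigcup_(w in range k) (k @^-1` [set w] `&` f w @^-1` [set z])).
  apply: fin_bigcup_measurable => [|w _]; first exact: sk.1.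
  by apply: measurableI; [exact: sk.2|exact: (sf w).2].
apply/seteqP; split=> [x /= <-|x [w _ [/= -> //]]].
by exists (k x) => //; exists x.
Qed.

Lemma step_comp (W Z : Type) (h : W -> Z) (f : R -> W) :
  step f -> step (h \o f).
Proof.
by move=> sf; apply: (step_glue (f := fun w _ => h w) sf) => w; exact: step_cst.
Qed.

Lemma step_comp2 (W W' Z : Type) (h : W -> W' -> Z) f g :
  step f -> step g -> step (fun x => h (f x) (g x)).
Proof.
by move=> sf sg; apply: (step_glue sf (f := fun w x => h w (g x))) => w; exact: step_comp.
Qed.

Lemma step_real_measurable (f : R -> R) : step f -> measurable_fun setT f.
Proof. by move=> sf _ Y mY; rewrite setTI; exact: step_measurable. Qed.

Lemma step_mem (E : set R) : measurable E -> step (fun x => x \in E).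
Proof.
move=> mE; split=> [|b].
  exact: finite_finset.
case: b.
  rewrite (_ : _ @^-1` _ = E)//.
  by apply/seteqP; split=> x /=; [exact: set_mem|exact: mem_set].
rewrite (_ : _ @^-1` _ = ~` E); first exact: measurableC.
by apply/seteqP; split=> x /=; [move=> h /mem_set; rewrite h|exact: memNset].
Qed.

End Step.

Section BorelLimit.
Context {R : realType}.
Implicit Types V W : normedModType R[i].

(** Pointwise limits of step functions, with no exceptional set. *)
Definition step_limit V (f : R -> V) : Prop :=
  exists s : nat -> R -> V, (forall n, simple_function (s n)) /\
    forall x, s n x @[n --> \oo] --> f x.

Lemma step_limit_simple V (f : R -> V) : simple_function f -> step_limit f.
Proof. by move=> sf; exists (fun=> f); split=> // x; exact: cvg_cst. Qed.

Lemma step_limit0 V : step_limit (fun=> 0 : V).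
Proof. by apply: step_limit_simple; exact: step_cst. Qed.

Lemma step_limitD V (f g : R -> V) : step_limit f -> step_limit g ->
  step_limit (fun x => f x + g x).
Proof.
move=> [s [ss sf]] [t [st tg]]; exists (fun n x => s n x + t n x); split=> [n|x].
  exact: (step_comp2 (fun v w => v + w) (ss n) (st n)).
exact: cvgD.
Qed.

Lemma step_limit_comp V W (L : V -> W) (f : R -> V) : bounded_linear L ->
  step_limit f -> step_limit (L \o f).
Proof.
move=> bL [s [ss sf]]; exists (fun n => L \o s n); split=> [n|x].
  exact: (step_comp L (ss n)).
exact: (bounded_linear_cvg bL).
Qed.

Lemma step_limitZ V a (f : R -> V) : step_limit f -> step_limit (fun x => a *: f x).
Proof.
move=> [s [ss sf]]; exists (fun n x => a *: s n x); split=> [n|x].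
  exact: (step_comp (fun v => a *: v) (ss n)).
exact: cvgZr.
Qed.

Lemma step_limitN V (f : R -> V) : step_limit f -> step_limit (fun x => - f x).
Proof.
move=> [s [ss sf]]; exists (fun n x => - s n x); split=> [n|x].
  exact: (step_comp (fun v => - v) (ss n)).
exact: cvgN.
Qed.

(** Gluing along a countable Borel partition, the fibres of k.  The n-th
    approximant is truncated to 0 where n < k x, to keep finitely many values. *)
Lemma step_limit_glue V (k : R -> nat) (f : nat -> R -> V) :
  (forall n, measurable (k @^-1` [set n])) ->
  (forall n, step_limit (f n)) -> step_limit (fun x => f (k x) x).
Proof.
move=> mk /choice[s hs].
have mkS (Y : set nat) : measurable (k @^-1` Y).
  rewrite (_ : _ @^-1` _ = \bigcup_(n in Y) (k @^-1` [set n])).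
    exact: bigcup_measurable.
  by apply/seteqP; split=> [x Yx|x [n Yn /= ->]//]; exists (k x).
pose t n x := if (k x <= n)%N then s (k x) n x else 0.
exists t; split=> [n|x].
  pose k' x := minn (k x) n.+1.
  have sk' : step k'.
    split=> [|w]; last exact: (mkS [set m | minn m n.+1 = w]).
    apply: sub_finite_set (finite_II n.+2) => _ [x _ <-] /=.
    by rewrite /k' ltnS geq_minr.
  pose g w := if (w <= n)%N then s w n else fun=> 0.
  have sg w : step (g w).
    rewrite /g; case: ifP => _; last exact: step_cst.
    by have [h _] := hs w; exact: h.
  have := step_glue sk' sg; rewrite (_ : (fun x => _) = t n)//.
  apply/funext => x; rewrite /t /g /k' /minn.
  by case: ltnP => h; [rewrite -ltnS h|rewrite ltnn leqNgt h].
have [_ h] := hs (k x); apply: cvg_trans (h x).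
apply: near_eq_cvg; exists (k x) => // n /= kn.
by rewrite /t kn.
Qed.

Lemma step_limit_restrict V (E : set R) (f : R -> V) : measurable E ->
  step_limit f -> step_limit (fun x => if x \in E then f x else 0).
Proof.
move=> mE sf.
pose g n := if n is 0%N then (fun=> 0 : V) else f.
have := @step_limit_glue _ (fun x => (x \in E) : nat) g.
rewrite (_ : (fun x => g _ x) = (fun x => if x \in E then f x else 0)).
  apply=> [n|[|n]//]; last exact: step_limit0.
  exact: (step_measurable [set b : bool | nat_of_bool b = n] (step_mem mE)).
by apply/funext => x; case: (x \in E).
Qed.

Lemma step_limit_nrm V (f : R -> V) : step_limit f ->
  measurable_fun setT (fun x => nrm (f x)).
Proof.
move=> [s [ss sf]]; apply: (measurable_fun_cvg (h := fun n x => nrm (s n x))) => [n|x _].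
  by apply: step_real_measurable; exact: (step_comp (@nrm R V) (ss n)).
exact: cvg_nrm.
Qed.

(** Every strongly measurable function on a Borel set agrees almost everywhere
    on it with an everywhere limit of step functions. *)
Lemma strongly_measurable_step_limit V (D : set R) (f : R -> V) :
  measurable D -> strongly_measurable D f ->
  exists g : R -> V, [/\ step_limit g, forall x, ~ D x -> g x = 0 &
    {ae (@lebesgue_measure R), forall x, D x -> f x = g x}].
Proof.
move=> mD [s [ss [N [mN N0 hN]]]].
have mE : measurable (D `\` N) by exact: measurableD.
exists (fun x => if x \in D `\` N then f x else 0); split.
- exists (fun n x => if x \in D `\` N then s n x else 0); split=> [n|x].
    exact: (step_comp2 (fun b v => if b then v else 0) (step_mem mE) (ss n)).
  case: ifPn => [|_]; last exact: cvg_cst.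
  rewrite in_setE => -[Dx Nx]; apply: contrapT => h; apply: Nx; apply: hN => /= h'.
  exact/h/h'.
- by move=> x Dx; case: ifPn => //; rewrite in_setE => -[].
- exists N; split=> // x /= h; apply: contrapT => Nx; apply: h => Dx.
  by rewrite ifT// in_setE; split.
Qed.

End BorelLimit.

(** * Integrals of simple functions *)

Section SimpleIntegral.
Context {R : realType}.
Local Notation mu := (@lebesgue_measure R).
Variable D : set R.
Hypotheses (mD : measurable D) (fD : (mu D < +oo)%E).

Lemma measure_setI_fin_num E : measurable E -> mu (D `&` E) \is a fin_num.
Proof.
move=> mE; rewrite ge0_fin_numE// (le_lt_trans _ fD)//.
by apply: le_measure; rewrite ?inE//; exact: measurableI.
Qed.

Lemma simple_integrable (V : normedModType R[i]) (s : R -> V) :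
  simple_function s -> integrable_simple D s.
Proof.
move=> ss; split=> // v _.
rewrite -ge0_fin_numE//; apply: measure_setI_fin_num; exact: ss.2.
Qed.

Lemma fine_measure_step (W : choiceType) (p : R -> W) (Y : set W) : step p ->
  fine (mu (D `&` p @^-1` Y)) =
  \sum_(w <- fset_set (range p) | w \in Y) fine (mu (D `&` p @^-1` [set w])).
Proof.
move=> sp.
pose E w := if w \in Y then D `&` p @^-1` [set w] else set0.
have mE w : measurable (E w).
  by rewrite /E; case: ifP => // _; apply: measurableI => //; exact: sp.2.
have -> : D `&` p @^-1` Y = \bigcup_(w in range p) E w.
  apply/seteqP; split=> [x [Dx Yx]|x [w _]].
    by exists (p x); [exists x|rewrite /E mem_set].
  rewrite /E; case: ifPn => // /set_mem Yw [Dx /= xw].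
  by split=> //=; rewrite xw.
have tE : trivIset (range p) E.
  move=> u w _ _ [x []]; rewrite /E.
  by case: ifP => // _ [_ /= <-]; case: ifP => // _ [_ /= <-].
rewrite measure_fin_bigcup; last 3 first.
- exact: sp.1.
- exact: tE.
- by move=> w _; exact: mE.
rewrite fsbig_finite/=; last exact: sp.1.
rewrite -sum_fine => [|w _]; last first.
  rewrite /E; case: ifP => _; last by rewrite measure0.
  by apply: measure_setI_fin_num; exact: sp.2.
rewrite [RHS]big_mkcond/=; apply: eq_bigr => w _.
by rewrite /E; case: ifP => // _; rewrite measure0.
Qed.

(** The simple integral of a function of a step function p may be computed on
    the fibres of p instead of on its own fibres. *)
Lemma simple_integral_comp (W : choiceType) (V : normedModType R[i])
    (p : R -> W) (F : W -> V) : step p ->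
  simple_integral D (F \o p) =
  \sum_(w <- fset_set (range p)) (fine (mu (D `&` p @^-1` [set w])))%:C *: F w.
Proof.
move=> sp; have sFp := step_comp F sp.
rewrite /simple_integral fsbig_finite/=; last exact: sFp.1.
transitivity (\sum_(v <- fset_set (range (F \o p)))
   \sum_(w <- fset_set (range p) | F w == v)
     (fine (mu (D `&` p @^-1` [set w])))%:C *: F w).
  apply: eq_bigr => v _.
  rewrite -[_ @^-1` _]/(p @^-1` [set w | F w = v]) fine_measure_step//.
  rewrite (eq_bigl (fun w => F w == v)); last first.
    move=> w; apply/idP/eqP => [/set_mem//|h]; exact: mem_set.
  rewrite raddf_sum scaler_suml; apply: eq_bigr => w /eqP ->//.
rewrite (exchange_big_dep xpredT)//=; apply: eq_big_seq => w.
rewrite in_fset_set; last exact: sp.1.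
move=> /set_mem[x _ xw].
have Fw : F w \in fset_set (range (F \o p)).
  by rewrite in_fset_set; [apply: mem_set; exists x; rewrite //= xw|exact: sFp.1].
rewrite big_mkcond (bigD1_seq (F w)) ?fset_uniq//.
rewrite eqxx big1 => [|v]; first exact: addr0.
by rewrite eq_sym => /negPf ->.
Qed.

Lemma simple_integralE (V : normedModType R[i]) (s : R -> V) : step s ->
  simple_integral D s =
  \sum_(v <- fset_set (range s)) (fine (mu (D `&` s @^-1` [set v])))%:C *: v.
Proof. exact: (@simple_integral_comp _ _ _ id). Qed.

Lemma simple_integralB (V : normedModType R[i]) (s t : R -> V) :
  simple_function s -> simple_function t ->
  simple_integral D (fun x => s x - t x) =
  simple_integral D s - simple_integral D t.
Proof.
move=> ss st; have sp := step_comp2 pair ss st.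
have h := simple_integral_comp _ sp.
rewrite [LHS](h _ (fun w : V * V => w.1 - w.2)).
rewrite [X in _ = X - _](h _ fst) [X in _ = _ - X](h _ snd) -sumrB.
by apply: eq_bigr => w _; rewrite scalerBr.
Qed.

Lemma simple_integralD (V : normedModType R[i]) (s t : R -> V) :
  simple_function s -> simple_function t ->
  simple_integral D (fun x => s x + t x) =
  simple_integral D s + simple_integral D t.
Proof.
move=> ss st; have sp := step_comp2 pair ss st.
have h := simple_integral_comp _ sp.
rewrite [LHS](h _ (fun w : V * V => w.1 + w.2)).
rewrite [X in _ = X + _](h _ fst) [X in _ = _ + X](h _ snd) -big_split.
by apply: eq_bigr => w _; rewrite scalerDr.
Qed.

Lemma simple_integralZ (V : normedModType R[i]) a (s : R -> V) :
  simple_function s ->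
  simple_integral D (fun x => a *: s x) = a *: simple_integral D s.
Proof.
move=> ss; rewrite [LHS](simple_integral_comp (fun v => a *: v) ss).
rewrite simple_integralE// scaler_sumr; apply: eq_bigr => w _.
by rewrite !scalerA mulrC.
Qed.

Lemma integral_step (W : choiceType) (p : R -> W) (F : W -> R) : step p ->
  (forall w, 0 <= F w) ->
  (\int[mu]_(x in D) (F (p x))%:E)%E =
  (\sum_(w <- fset_set (range p)) fine (mu (D `&` p @^-1` [set w])) * F w)%:E.
Proof.
move=> sp F0.
transitivity (\int[mu]_(x in D) \sum_(w <- fset_set (range p))
    ((F w)%:E * (\1_(p @^-1` [set w]) x)%:E))%E.
  apply: eq_integral => x _.
  have px : p x \in fset_set (range p).
    by rewrite in_fset_set; [apply: mem_set; exists x|exact: sp.1].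
  rewrite (bigD1_seq (p x))//= big1_seq ?adde0.
    by rewrite indicE mem_set// mule1.
  move=> w /andP[wx _]; rewrite indicE memNset ?mule0//= => h.
  by move/eqP : wx; apply.
rewrite ge0_integral_sum//=; last 2 first.
- move=> w; apply: measurable_funeM; apply/measurable_EFinP.
  by apply: measurable_indic; exact: sp.2.
- by move=> w x _; rewrite mule_ge0// lee_fin.
rewrite -sumEFin; apply: eq_bigr => w _.
rewrite ge0_integralZl//=; last 2 first.
- by apply/measurable_EFinP; apply: measurable_indic; exact: sp.2.
- by rewrite lee_fin.
rewrite integral_indic//=; last exact: sp.2.
rewrite setIC EFinM fineK; first by rewrite muleC.
by apply: measure_setI_fin_num; exact: sp.2.
Qed.

Lemma simple_integral_norm (V : normedModType R[i]) (s : R -> V) :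
  simple_function s ->
  ((nrm (simple_integral D s))%:E <= \int[mu]_(x in D) (nrm (s x))%:E)%E.
Proof.
move=> ss; rewrite (integral_step ss) => [|v]; last exact: nrm_ge0.
rewrite lee_fin simple_integralE// (le_trans (nrm_sum _ _ _))//.
apply: ler_sum => v _; rewrite nrmZ nrmR ger0_norm//.
exact: fine_ge0.
Qed.

End SimpleIntegral.

(** * Reflection of the line, and integrals up to null sets *)

Section LebesgueInvariance.
Context {R : realType}.
Local Notation mu := (@lebesgue_measure R).

Lemma measurable_reflect (c : R) :
  measurable_fun setT ((fun x => c - x) : measurableTypeR R -> measurableTypeR R).
Proof. by apply: measurable_funB. Qed.

Lemma lebesgue_measure_reflect (c : R) (E : set R) : measurable E ->
  mu ((fun x => c - x) @^-1` E) = mu E.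
Proof.
move=> mE; have mr := measurable_reflect c.
suff : pushforward mu ((fun x => c - x) : _ -> measurableTypeR R) E = mu E by [].
apply/esym/lebesgue_measure_unique => //= _ [[a b]] _ <-.
rewrite /pushforward/= (_ : _ @^-1` _ = `[c - b, c - a[%classic); last first.
  apply/seteqP; split=> x /=; rewrite !in_itv/=; lra.
rewrite !lebesgue_measure_itv/= !lte_fin ltrD2l ltrN2.
by case: ifP => // _; rewrite -!EFinD; congr _%:E; ring.
Qed.

Lemma measurable_preimage_reflect (c : R) (E : set R) : measurable E ->
  measurable ((fun x => c - x) @^-1` E).
Proof. by move=> mE; rewrite -[X in measurable X]setTI; apply: (measurable_reflect c). Qed.

Lemma integral_reflect (c : R) (f : R -> \bar R) : measurable_fun setT f ->
  (forall x, (0 <= f x)%E) ->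
  (\int[mu]_(x in `]0%R, c[) f (c - x)%R)%E = (\int[mu]_(x in `]0%R, c[) f x)%E.
Proof.
move=> mf f0; have mr := measurable_reflect c.
have E : `]0, c[%classic =
    ((fun x => c - x) : _ -> measurableTypeR R) @^-1` `]0, c[%classic.
  by apply/seteqP; split=> x /=; rewrite !in_itv/=; lra.
rewrite [in LHS]E -[LHS](@ge0_integral_pushforward _ _ _ _ _ _ mr mu _ f)//=.
- apply: eq_measure_integral => //= A mA _; exact: lebesgue_measure_reflect.
- exact: measurable_funS mf.
Qed.

Import HBNNSimple.

(** The integral of a nonnegative function is monotone for the almost
    everywhere order, even without measurability. *)
Lemma le_ae_integral (D : set R) (f g : R -> \bar R) (N : set R) :
  measurable N -> mu N = 0%E -> (forall x, 0 <= f x)%E -> (forall x, 0 <= g x)%E ->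
  (forall x, D x -> ~ N x -> (f x <= g x)%E) ->
  (\int[mu]_(x in D) f x <= \int[mu]_(x in D) g x)%E.
Proof.
move=> mN N0 f0 g0 fg; rewrite !ge0_integralE//.
apply: ub_ereal_sup => _ [h /= hf <-].
have mNC : measurable (~` N) by exact: measurableC.
(* a simple minorant h of f becomes a minorant of g once set to 0 on N *)
apply: ereal_sup_ubound; exists (proj_nnsfun h mNC) => /=.
  move=> x; have := hf x; rewrite /patch mindicE.
  have [xN|xN] := pselect (N x).
    have -> : (x \in ~` N) = false by apply: memNset => /(_ xN).
    by rewrite mulr0; case: ifP.
  have -> : (x \in ~` N) = true by apply: mem_set.
  rewrite mulr1; case: ifPn => [/set_mem Dx|//] h1.
  by rewrite (le_trans h1)// fg.
rewrite -!integralT_nnsfun; apply: ge0_ae_eq_integral => //.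
- exact/measurable_EFinP/measurable_funP.
- exact/measurable_EFinP/measurable_funP.
- by move=> x _; rewrite lee_fin.
- by move=> x _; rewrite lee_fin.
- exists N; split=> // x /= xN; apply: contrapT => Nx; apply: xN => _.
  have xNC : (x \in ~` N) = true by apply: mem_set.
  by rewrite mindicE xNC mulr1.
Qed.

Lemma ae_eq_integral_ge0 (D : set R) (f g : R -> \bar R) :
  (forall x, 0 <= f x)%E -> (forall x, 0 <= g x)%E ->
  {ae mu, forall x, D x -> f x = g x} ->
  (\int[mu]_(x in D) f x = \int[mu]_(x in D) g x)%E.
Proof.
move=> f0 g0 [N [mN N0 hN]].
have fg x : D x -> ~ N x -> f x = g x.
  by move=> Dx Nx; apply: contrapT => h; apply/Nx/hN => /= /(_ Dx).
by apply/eqP; rewrite eq_le; apply/andP; split;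
  apply: (le_ae_integral mN N0) => // x Dx Nx; rewrite fg.
Qed.

End LebesgueInvariance.

(** * The Bochner integral *)

#[global] Instance lebesgue_ae_filter {R : realType} :
  Filter (nbhs (almost_everywhere (@lebesgue_measure R))).
Proof. exact: (ae_filter_ringOfSetsType (@lebesgue_measure R)). Qed.

Lemma measurable_superlevel {R : realType} (V : normedModType R[i])
    (f : R -> V) (c : R) :
  step_limit f -> measurable [set x | c <= nrm (f x)].
Proof.
move=> sf; rewrite -[X in measurable X]setTI.
by apply: measurable_fun_le => //; exact: step_limit_nrm.
Qed.

Section Bochner.
Context {R : realType}.
Local Notation mu := (@lebesgue_measure R).
Variable D : set R.
Hypotheses (mD : measurable D) (fD : (mu D < +oo)%E).
Implicit Types V W : normedModType R[i].

Local Notation L1norm f := (\int[mu]_(x in D) (nrm (f x))%:E)%E.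

Lemma cvge0_small (u : nat -> \bar R) (e : R) : 0 < e ->
  u n @[n --> \oo] --> 0%E -> \forall n \near \oo, (u n < e%:E)%E.
Proof.
move=> e0 h; apply: (h [set x | (x < e%:E)%E]); apply: open_nbhs_nbhs; split.
  exact: open_ereal_lt_ereal.
by rewrite /= lte_fin.
Qed.

Lemma step_limit_nrm_measurable V (f : R -> V) : step_limit f ->
  measurable_fun D (fun x => (nrm (f x))%:E).
Proof.
move=> sf; apply/measurable_EFinP.
by apply: measurable_funS (step_limit_nrm sf).
Qed.

Lemma L1norm_ge0 V (f : R -> V) : (0 <= L1norm f)%E.
Proof. by apply: integral_ge0 => x _; rewrite lee_fin nrm_ge0. Qed.

Lemma L1norm_le V W (f : R -> V) (g : R -> W) : step_limit f -> step_limit g ->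
  (forall x, D x -> nrm (f x) <= nrm (g x)) -> (L1norm f <= L1norm g)%E.
Proof.
move=> sf sg fg; apply: ge0_le_integral => //.
- by move=> x _; rewrite lee_fin nrm_ge0.
- exact: step_limit_nrm_measurable.
- exact: step_limit_nrm_measurable.
Qed.

Lemma L1norm_leD V (f g h : R -> V) : step_limit f -> step_limit g ->
  step_limit h -> (forall x, nrm (h x) <= nrm (f x) + nrm (g x)) ->
  (L1norm h <= L1norm f + L1norm g)%E.
Proof.
move=> sf sg sh hfg; rewrite -ge0_integralD//; last 4 first.
- by move=> x _; rewrite lee_fin nrm_ge0.
- exact: step_limit_nrm_measurable.
- by move=> x _; rewrite lee_fin nrm_ge0.
- exact: step_limit_nrm_measurable.
apply: ge0_le_integral => //.
- by move=> x _; rewrite lee_fin nrm_ge0.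
- exact: step_limit_nrm_measurable.
- by apply: emeasurable_funD; exact: step_limit_nrm_measurable.
- by move=> x _; rewrite -EFinD lee_fin.
Qed.

Lemma L1normZ V a (f : R -> V) : step_limit f ->
  L1norm (fun x => a *: f x) = ((nrm a)%:E * L1norm f)%E.
Proof.
move=> sf; rewrite -ge0_integralZl//; last 3 first.
- exact: step_limit_nrm_measurable.
- by move=> x _; rewrite lee_fin nrm_ge0.
- by rewrite lee_fin nrm_ge0.
by apply: eq_integral => x _; rewrite nrmZ EFinM.
Qed.

Lemma step_limitB V (f g : R -> V) : step_limit f -> step_limit g ->
  step_limit (fun x => f x - g x).
Proof. by move=> sf sg; apply: step_limitD => //; exact: step_limitN. Qed.

Lemma has_bochner_integral_norm V (f : R -> V) (y : V) : step_limit f ->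
  has_bochner_integral D f y -> ((nrm y)%:E <= L1norm f)%E.
Proof.
move=> sf [s [ss _ s0 sy]]; apply/lee_addgt0Pr => e e0.
have e2 : 0 < e / 2 by rewrite divr_gt0.
have /cvg_nrmP/(_ _ e2)[N1 _ h1] := sy.
have [N2 _ h2] := cvge0_small e2 s0.
pose n := maxn N1 N2.
have hn1 := h1 n (leq_maxl _ _); have hn2 := h2 n (leq_maxr _ _).
have sn : step_limit (s n) by apply: step_limit_simple; have [] := ss n.
have h3 : (L1norm (s n) <= L1norm (fun w => f w - s n w) + L1norm f)%E.
  apply: L1norm_leD => //; first exact: step_limitB.
  by move=> x; rewrite nrmBC addrC nrm_leD.
have h4 := simple_integral_norm mD fD (ss n).1.
rewrite (@le_trans _ _ ((nrm (simple_integral D (s n)))%:E + (e / 2)%:E)%E)//.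
  rewrite -EFinD lee_fin (le_trans (nrm_leD _ (simple_integral D (s n))))//.
  by rewrite lerD2l ltW.
rewrite {2}[e]splitr EFinD addeA leeD2r// (le_trans h4)// (le_trans h3)//.
by rewrite addeC leeD2l// ltW.
Qed.

Lemma has_bochner_integralD V (f g : R -> V) (y z : V) :
  step_limit f -> step_limit g ->
  has_bochner_integral D f y -> has_bochner_integral D g z ->
  has_bochner_integral D (fun x => f x + g x) (y + z).
Proof.
move=> sf sg [s [ss sa s0 sy]] [t [st ta t0 tz]].
exists (fun n x => s n x + t n x); split.
- move=> n; apply: simple_integrable => //.
  exact: (step_comp2 (fun v w => v + w) (ss n).1 (st n).1).
- move: sa ta; apply: filterS2 => x hs ht Dx; apply: cvgD; [exact: hs|exact: ht].
- have st0 : (L1norm (fun w => f w - s n w) + L1norm (fun w => g w - t n w))%E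
      @[n --> \oo] --> 0%E.
    by rewrite -[0%E]adde0; apply: cvgeD.
  apply: squeeze_cvge (cvg_cst 0%E) st0; apply: nearW => n.
  have sn : step_limit (s n) by apply: step_limit_simple; have [] := ss n.
  have tn : step_limit (t n) by apply: step_limit_simple; have [] := st n.
  rewrite L1norm_ge0/=; apply: L1norm_leD => [||| x].
  - exact: step_limitB.
  - exact: step_limitB.
  - by apply: step_limitB; exact: step_limitD.
  - by rewrite opprD addrACA nrmD.
- rewrite (_ : (fun n => _) = (fun n => simple_integral D (s n) + simple_integral D (t n))).
    exact: cvgD.
  by apply/funext => n; rewrite simple_integralD//; [have [] := ss n|have [] := st n].
Qed.

Lemma has_bochner_integralZ V a (f : R -> V) (y : V) : step_limit f ->
  has_bochner_integral D f y ->
  has_bochner_integral D (fun x => a *: f x) (a *: y).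
Proof.
move=> sf [s [ss sa s0 sy]]; exists (fun n x => a *: s n x); split.
- move=> n; apply: simple_integrable => //.
  exact: (step_comp (fun v => a *: v) (ss n).1).
- by apply: filterS sa => x hs Dx; apply: cvgZr; exact: hs.
- have s0' : ((nrm a)%:E * L1norm (fun w => f w - s n w))%E @[n --> \oo] --> 0%E.
    by rewrite -[0%E](mule0 (nrm a)%:E); apply: cvgeZl.
  rewrite (_ : (fun n => _) =
      (fun n => (nrm a)%:E * L1norm (fun w => f w - s n w))%E)//.
  apply/funext => n; rewrite -L1normZ; last first.
    by apply: step_limitB => //; apply: step_limit_simple; have [] := ss n.
  by apply: eq_integral => x _; rewrite scalerBr.
- rewrite (_ : (fun n => _) = (fun n => a *: simple_integral D (s n))).
    exact: cvgZr.
  by apply/funext => n; rewrite simple_integralZ//; have [] := ss n.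
Qed.

Lemma has_bochner_integral_unique V (f : R -> V) (y z : V) : step_limit f ->
  has_bochner_integral D f y -> has_bochner_integral D f z -> y = z.
Proof.
move=> sf hy hz; have hz' := has_bochner_integralZ (- 1) sf hz.
have := has_bochner_integralD sf (step_limitZ (- 1) sf) hy hz'.
move=> /(has_bochner_integral_norm (step_limitD sf (step_limitZ (- 1) sf))).
rewrite (eq_integral (fun=> 0%E)); last first.
  by move=> x _; rewrite scaleN1r subrr nrm0.
rewrite integral0 lee_fin scaleN1r => h.
have /nrm_eq0/eqP : nrm (y - z) = 0 by apply/eqP; rewrite eq_le h nrm_ge0.
by rewrite subr_eq0 => /eqP.
Qed.

Lemma has_bochner_integral_ae V (f g : R -> V) (y : V) :
  {ae mu, forall x, D x -> f x = g x} ->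
  has_bochner_integral D f y -> has_bochner_integral D g y.
Proof.
move=> fg [s [ss sa s0 sy]]; exists s; split=> //.
- by apply: filterS2 fg sa => x h hs Dx; rewrite -h//; exact: hs.
- rewrite (_ : (fun n => _) =
      (fun n => \int[mu]_(w in D) (nrm (f w - s n w))%:E)%E)//.
  apply/funext => n; apply: ae_eq_integral_ge0 => [x|x|].
  - by rewrite lee_fin nrm_ge0.
  - by rewrite lee_fin nrm_ge0.
  - by apply: filterS fg => x h Dx; rewrite h.
Qed.

(** A limit of step functions with integrable norm is Bochner integrable. *)
Lemma step_limit_bochner (V : completeNormedModType R[i]) (f : R -> V) :
  step_limit f -> (L1norm f < +oo)%E ->
  exists y : V, has_bochner_integral D f y.
Proof.
move=> sf fi; have [t [st tf]] := sf.
(* replacing t n by 0 off E n keeps it dominated by twice the norm of f, and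
   changes nothing in the limit *)
pose E n := [set x | nrm (t n x) <= 2 * nrm (f x)].
have mE n : measurable (E n).
  rewrite -[E n]setTI; apply: measurable_fun_le => //.
    exact: (step_limit_nrm (step_limit_simple (st n))).
  by apply: measurable_funM => //; exact: step_limit_nrm.
pose s n x := if x \in E n then t n x else 0.
have ss n : simple_function (s n).
  exact: (step_comp2 (fun (b : bool) v => if b then v else 0) (step_mem (mE n)) (st n)).
have sl n : step_limit (s n) by exact: step_limit_simple.
have sn x n : nrm (s n x) <= 2 * nrm (f x).
  rewrite /s; case: ifPn => [/set_mem//|_].
  by rewrite nrm0 mulr_ge0// nrm_ge0.
have sx x : s n x @[n --> \oo] --> f x.
  have [f0|f0] := eqVneq (nrm (f x)) 0.
    rewrite (nrm_eq0 f0); apply: cvg_near_cst; apply: nearW => n.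
    apply: nrm_eq0; apply/eqP; rewrite eq_le nrm_ge0 andbT.
    by have := sn x n; rewrite f0 mulr0.
  apply: cvg_trans (tf x); apply: near_eq_cvg.
  have fp : 0 < nrm (f x) by rewrite lt_def f0 nrm_ge0.
  have /cvg_nrmP/(_ _ fp) := tf x; apply: filterS => n hn.
  rewrite /s mem_set// /E/= (le_trans (nrm_leD _ (f x)))// nrmBC mulr_natl mulr2n.
  by rewrite lerD2l ltW.
have mfs n : measurable_fun D (fun x => (nrm (f x - s n x))%:E).
  by apply: step_limit_nrm_measurable; exact: step_limitB.
have s0 : (\int[mu]_(x in D) (nrm (f x - s n x))%:E)%E @[n --> \oo] --> 0%E.
  have [|||||_ _] := @dominated_convergence _ _ _ mu D mD
    (fun n x => (nrm (f x - s n x))%:E) (fun=> 0%E) (fun x => 3%:E * (nrm (f x))%:E)%E.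
  - exact: mfs.
  - exact: measurable_cst.
  - apply: aeW => x Dx; apply/cvg_EFin; first exact: nearW.
    apply/cvgrPdist_lt => e e0; have /cvg_nrmP/(_ _ e0) := sx x.
    by apply: filterS => n h; rewrite sub0r normrN ger0_norm// nrm_ge0.
  - apply: integrableZl => //; apply/integrableP; split.
      exact: step_limit_nrm_measurable.
    apply: le_lt_trans fi; rewrite le_eqVlt; apply/orP; left; apply/eqP; apply: eq_integral => x _.
    by rewrite abse_EFin ger0_norm// nrm_ge0.
  - apply: aeW => x n Dx; rewrite abse_EFin ger0_norm ?nrm_ge0// -EFinM lee_fin.
    by rewrite (le_trans (nrmB _ _))//; have := sn x n; lra.
  - by rewrite integral0.
have SIc : forall e : R, 0 < e -> exists N, forall n m, (N <= n)%N -> (N <= m)%N ->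
    nrm (simple_integral D (s n) - simple_integral D (s m)) < e.
  move=> e e0; have [|N _ hN] := cvge0_small _ s0 (e := e / 2).
    by rewrite divr_gt0.
  exists N => n m Nn Nm; rewrite -simple_integralB// -lte_fin.
  apply: le_lt_trans (simple_integral_norm _ _ _) _ => //.
    exact: (step_comp2 (fun v w => v - w) (ss n) (ss m)).
  rewrite [e]splitr EFinD.
  apply: (@le_lt_trans _ _ (L1norm (fun x => f x - s n x)%R +
      L1norm (fun x => f x - s m x)%R)%E).
    apply: L1norm_leD => [|||x]; try exact: step_limitB.
    exact: nrm_dist3.
  by apply: lteD; exact: hN.
have [y hy] := cauchy_nrm_cvg SIc.
exists y, s; split=> //; first by move=> n; exact: simple_integrable.
by apply: aeW => x Dx; exact: sx.
Qed.

End Bochner.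

(** * Extension and reflection of the domain of integration *)

Section BochnerDomain.
Context {R : realType}.
Local Notation mu := (@lebesgue_measure R).
Implicit Types V : normedModType R[i].

Lemma simple_integral_extend V (D D' : set R) (s : R -> V) :
  measurable D -> measurable D' -> (mu D' < +oo)%E -> D `<=` D' ->
  simple_function s ->
  simple_integral D' (fun x => if x \in D then s x else 0) = simple_integral D s.
Proof.
move=> mD mD' fD' DD' ss.
have fD : (mu D < +oo)%E.
  by rewrite (le_lt_trans _ fD')//; apply: le_measure; rewrite ?inE.
have sp := step_comp2 pair ss (step_mem mD).
rewrite [LHS](simple_integral_comp mD' fD' (fun w : V * bool => if w.2 then w.1 else 0) sp).
rewrite [RHS](simple_integral_comp mD fD fst sp).
apply: eq_bigr => -[v [|]] _ /=.
  congr ((fine (mu _))%:C *: v); apply/seteqP; split=> x [Dx [xv xD]].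
    by split=> //=; [apply: set_mem|rewrite xv xD].
  by split=> //=; [exact: DD'|rewrite xv xD].
rewrite (_ : D `&` _ = set0) ?measure0 ?scale0r ?scaler0//.
by apply/seteqP; split=> // x [Dx [_]]; rewrite mem_set.
Qed.

Lemma has_bochner_integral_extend V (D D' : set R) (f : R -> V) y :
  measurable D -> measurable D' -> (mu D' < +oo)%E -> D `<=` D' ->
  has_bochner_integral D f y ->
  has_bochner_integral D' (fun x => if x \in D then f x else 0) y.
Proof.
move=> mD mD' fD' DD' [s [ss sa s0 sy]].
exists (fun n x => if x \in D then s n x else 0); split.
- move=> n; apply: (simple_integrable mD' fD').
  exact: (step_comp2 (fun v (b : bool) => if b then v else 0) (ss n).1 (step_mem mD)).
- move: sa; apply: filterS => x h D'x; case: ifPn => [/set_mem Dx|_]; first exact: h.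
  exact: cvg_cst.
- rewrite (_ : (fun n => _) =
      (fun n => \int[mu]_(w in D) (nrm (f w - s n w))%:E)%E)//.
  apply/funext => n; rewrite [LHS]integral_mkcond [RHS]integral_mkcond.
  apply: eq_integral => x _; rewrite /patch.
  have [xD|xD] := boolP (x \in D); last by rewrite subr0 nrm0; case: ifP.
  by rewrite mem_set//; apply/DD'/set_mem.
- rewrite (_ : (fun n => _) = (fun n => simple_integral D (s n)))//.
  by apply/funext => n; rewrite simple_integral_extend//; exact: (ss n).1.
Qed.

Lemma step_reflect (W : Type) (c : R) (s : R -> W) : step s ->
  step (fun x => s (c - x)).
Proof.
move=> [fs ms]; split=> [|w]; last exact: (measurable_preimage_reflect c (ms w)).
by apply: sub_finite_set fs => _ [x _ <-]; exists (c - x).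
Qed.

Lemma step_limit_reflect V (c : R) (f : R -> V) : step_limit f ->
  step_limit (fun x => f (c - x)).
Proof.
move=> [s [ss sf]]; exists (fun n x => s n (c - x)); split=> // n.
exact: step_reflect (ss n).
Qed.

Lemma simple_integral_reflect V (c : R) (s : R -> V) : simple_function s ->
  simple_integral `]0, c[ (fun x => s (c - x)) = simple_integral `]0, c[ s.
Proof.
move=> ss; rewrite /simple_integral.
rewrite (_ : range (fun x => s (c - x)) = range s); last first.
  apply/seteqP; split=> _ [x _ <-]; first by exists (c - x).
  by exists (c - x) => //; rewrite subKr.
apply: eq_fsbigr => v _; congr ((fine _)%:C *: v).
rewrite -(lebesgue_measure_reflect c (E := `]0, c[ `&` s @^-1` [set v])).
  congr mu; apply/seteqP; split=> x [/= Dx <-]; split=> //=;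
    move: Dx; rewrite /= !in_itv/=; lra.
by apply: measurableI => //; exact: ss.2.
Qed.

Lemma ae_reflect (c : R) (P : R -> Prop) :
  {ae mu, forall x, P x} -> {ae mu, forall x, P (c - x)}.
Proof.
move=> [N [mN N0 hN]]; exists ((fun x => c - x) @^-1` N); split.
- exact: measurable_preimage_reflect.
- by rewrite -N0; exact: lebesgue_measure_reflect.
- by move=> x /= h; exact: hN.
Qed.

Lemma has_bochner_integral_reflect V (c : R) (f : R -> V) y : step_limit f ->
  has_bochner_integral `]0, c[%classic f y ->
  has_bochner_integral `]0, c[%classic (fun x => f (c - x)) y.
Proof.
move=> sf [s [ss sa s0 sy]]; exists (fun n x => s n (c - x)); split.
- move=> n; have [h1 h2] := ss n; split; first exact: step_reflect.
  move=> v v0; have := h2 v v0.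
  rewrite -(lebesgue_measure_reflect c (E := `]0, c[ `&` s n @^-1` [set v])); last first.
    by apply: measurableI => //; exact: h1.2.
  apply: le_lt_trans; rewrite le_eqVlt; apply/orP; left; apply/eqP.
  congr mu; apply/seteqP; split=> x [/= Dx <-]; split=> //=;
    move: Dx; rewrite /= !in_itv/=; lra.
- have := ae_reflect c sa; apply: filterS => x h Dx; apply: h.
  by move: Dx; rewrite /= !in_itv/=; lra.
- rewrite (_ : (fun n => _) =
      (fun n => \int[mu]_(w in `]0%R, c[) (nrm (f w - s n w))%:E)%E)//.
  apply/funext => n.
  apply: (integral_reflect c (f := fun w => (nrm (f w - s n w))%:E)) => [|x].
    apply/measurable_EFinP; apply: step_limit_nrm; apply: step_limitB => //.
    by apply: step_limit_simple; exact: (ss n).1.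
  by rewrite lee_fin nrm_ge0.
- rewrite (_ : (fun n => _) = (fun n => simple_integral `]0, c[ (s n)))//.
  by apply/funext => n; rewrite simple_integral_reflect//; exact: (ss n).1.
Qed.

End BochnerDomain.

(** * Measurability of orbits *)

Section Orbit.
Context {R : realType}.
Implicit Types V W : normedModType R[i].

(** The projection of the line onto [0, N]. *)
Definition clip (N x : R) : R := Num.max 0 (Num.min x N).

Lemma clip_ge0 N x : 0 <= clip N x.
Proof. by rewrite /clip le_max lexx. Qed.

Lemma clip_le N x : 0 <= N -> clip N x <= N.
Proof. by move=> N0; rewrite /clip ge_max N0 ge_min lexx orbT. Qed.

Lemma clip_id N x : 0 <= x -> x <= N -> clip N x = x.
Proof. by move=> x0 xN; rewrite /clip (min_idPl xN) (max_idPr x0). Qed.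

Lemma clip_homo N : {homo clip N : x y / x <= y}.
Proof.
move=> x y xy; rewrite /clip ge_max le_max lexx/= le_max; apply/orP; right.
by rewrite le_min !ge_min xy lexx !orbT.
Qed.

(** [grid N n x] is the largest multiple of 1 / (n + 1) that does not exceed the
    projection of x onto [0, N], and [grid_index N n x] is its multiplier. *)
Definition grid_index (N : R) n x : nat := Num.truncn (clip N x * n.+1%:R).
Definition grid (N : R) n x : R := (grid_index N n x)%:R / n.+1%:R.

Lemma step_grid (N : R) n : 0 <= N -> step (grid N n).
Proof.
move=> N0; rewrite -[grid N n]/((fun k : nat => k%:R / n.+1%:R) \o (grid_index N n)).
apply: step_comp.
have homo : {homo grid_index N n : x y / x <= y >-> (x <= y)%N}.
  move=> x y xy; apply: le_truncn.
  by rewrite ler_pM2r ?ltr0n// clip_homo.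
split.
  apply: sub_finite_set (finite_II (Num.truncn (N * n.+1%:R)).+1) => _ [x _ <-].
  by rewrite /= ltnS; apply: le_truncn; rewrite ler_pM2r ?ltr0n// clip_le.
move=> k; apply: is_interval_measurable => x y /= xk yk z /andP[xz zy].
by apply/eqP; rewrite eqn_leq; apply/andP; split; [rewrite -yk|rewrite -xk]; exact: homo.
Qed.

Lemma grid_bounds (N x : R) n : 0 <= N ->
  [/\ 0 <= grid N n x, grid N n x <= clip N x & clip N x - grid N n x < n.+1%:R^-1].
Proof.
move=> N0; have p0 : (0 : R) < n.+1%:R by rewrite ltr0n.
have /andP[h1 h2] : (grid_index N n x)%:R <= clip N x * n.+1%:R < (grid_index N n x).+1%:R.
  by apply: truncn_itv; rewrite mulr_ge0// clip_ge0.
split; first by rewrite divr_ge0.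
  by rewrite ler_pdivrMr.
by rewrite -(ltr_pM2r p0) mulVf ?gt_eqF// mulrBl /grid divfK ?gt_eqF// ltrBlDl natr1.
Qed.

(** Discretizing the time from below reduces the measurability of the orbit to
    the right continuity of S at 0 and its boundedness on [0, N]. *)
Lemma step_limit_orbit V (S : R -> V -> V) (N M : R) (v : R -> V) :
  0 <= N -> 0 <= M ->
  (forall t, 0 <= t -> linear (S t)) ->
  (forall t y, 0 <= t -> t <= N -> nrm (S t y) <= M * nrm y) ->
  (forall s t y, 0 <= s -> 0 <= t -> S (s + t) y = S s (S t y)) ->
  (forall y e, 0 < e -> exists2 d : R, 0 < d &
    forall h, 0 <= h -> h < d -> nrm (S h y - y) < e) ->
  step_limit v -> step_limit (fun x => S (clip N x) (v x)).
Proof.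
move=> N0 M0 lS bS SD Sc [t [st tv]].
exists (fun n x => S (grid N n x) (t n x)); split=> [n|x].
  exact: (step_comp2 S (step_grid n N0) (st n)).
apply/cvg_nrmP => e e0.
have e1 : 0 < e / (2 * (M + 1)) by rewrite divr_gt0//; lra.
have [d d0 hd] := Sc (v x) _ e1.
have /cvg_nrmP/(_ _ e1) h1 := tv x.
have h2 : \forall n \near \oo, (n.+1%:R)^-1 < d.
  have /cvgrPdist_lt/(_ _ d0) := @cvg_harmonic R.
  by apply: filterS => n; rewrite sub0r normrN ger0_norm ?harmonic_ge0.
move: h1 h2; apply: filterS2 => n h1 h2.
have [g0 gc cg] := grid_bounds x n N0.
have gN : grid N n x <= N by rewrite (le_trans gc)// clip_le.
have cg0 : 0 <= clip N x - grid N n x by rewrite subr_ge0.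
have -> : S (clip N x) (v x) - S (grid N n x) (t n x) =
    S (grid N n x) (S (clip N x - grid N n x) (v x) - v x) +
    S (grid N n x) (v x - t n x).
  rewrite -(mapD_linear (lS _ g0)) subrKA (mapB_linear (lS _ g0)) -SD//.
  by rewrite subrKC.
rewrite (le_lt_trans (nrmD _ _))//.
have h3 := hd _ cg0 (lt_trans cg h2).
have b1 := bS _ (S (clip N x - grid N n x) (v x) - v x) g0 gN.
have b2 := bS _ (v x - t n x) g0 gN.
move: h3 h1; rewrite !ltr_pdivlMr; [|lra|lra].
have := nrm_ge0 (v x - t n x); have := nrm_ge0 (S (clip N x - grid N n x) (v x) - v x).
lra.
Qed.

End Orbit.

(** * Uniform absolute continuity *)

Section GlidingHump.
Context {R : realType}.
Local Notation mu := (@lebesgue_measure R).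
Variable D : set R.
Hypotheses (mD : measurable D) (fD : (mu D < +oo)%E).
Context {U X : normedModType R[i]}.

Local Notation L1norm f := (\int[mu]_(x in D) (nrm (f x))%:E)%E.

Lemma L1norm_support (v : R -> U) (E : set R) (c : R) : step_limit v ->
  measurable E -> 0 <= c -> (forall x, nrm (v x) <= c) ->
  (forall x, ~ E x -> v x = 0) -> (L1norm v <= c%:E * mu (D `&` E))%E.
Proof.
move=> sv mE c0 vc vE.
rewrite setIC -integral_indic// -ge0_integralZl//; last first.
  by apply/measurable_EFinP; exact: measurable_indic.
apply: ge0_le_integral => //.
- by move=> x _; rewrite lee_fin nrm_ge0.
- exact: step_limit_nrm_measurable.
- apply: measurable_funeM.
  by apply/measurable_EFinP; exact: measurable_indic.
- move=> x _; rewrite -EFinM lee_fin indicE.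
  have [xE|xE] := boolP (x \in E); first by rewrite mulr1.
  by rewrite mulr0 vE ?nrm0//; move/negP : xE => h Ex; apply/h/mem_set.
Qed.

(** Integrable functions on D, as everywhere limits of step functions. *)
Definition L1fun (v : R -> U) : Prop := step_limit v /\ (L1norm v < +oo)%E.

Lemma bounded_L1fun (v : R -> U) (c : R) : step_limit v ->
  (forall x, nrm (v x) <= c) -> L1fun v.
Proof.
move=> sv vc; split=> //.
have c0 : 0 <= c by rewrite (le_trans _ (vc 0))// nrm_ge0.
apply: le_lt_trans (L1norm_support sv measurableT c0 vc _) _ => [x []//|].
rewrite setIT lte_mul_pinfty ?lee_fin//.
Qed.

Variable g : nat -> (R -> U) -> X.
Hypothesis gD : forall M v w, L1fun v -> L1fun w ->
  g M (fun x => v x + w x) = g M v + g M w.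
Hypothesis gK : forall M, exists2 K : R, 0 <= K &
  forall v, L1fun v -> ((nrm (g M v))%:E <= K%:E * L1norm v)%E.
Hypothesis gC : forall v (c : R), step_limit v -> (forall x, nrm (v x) <= c) ->
  exists l : X, g M v @[M --> \oo] --> l.

(** On functions vanishing off E and bounded by c, the maps g m with m <= M are
    controlled by the measure of D `&` E. *)
Lemma uniform_support_bound : exists K : nat -> R, (forall M, 0 < K M) /\
  forall m M v E (c d : R), (m <= M)%N -> step_limit v -> measurable E -> 0 <= c ->
    (forall x, nrm (v x) <= c) -> (forall x, ~ E x -> v x = 0) ->
    (mu (D `&` E) <= d%:E)%E -> nrm (g m v) <= K M * c * d.
Proof.
have /choice[k hk] M : exists K : R, 0 <= K /\
    forall v, L1fun v -> ((nrm (g M v))%:E <= K%:E * L1norm v)%E.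
  by have [K K0 hK] := gK M; exists K.
exists (fun M => 1 + \sum_(i < M.+1) k i); split=> [M|m M v E c d mM sv mE c0 vc vE Ed].
  by rewrite ltr_pwDl// sumr_ge0// => i _; have [] := hk i.
have [k0 hkm] := hk m.
rewrite -lee_fin (le_trans (hkm _ (bounded_L1fun sv vc)))//.
have h := le_trans (L1norm_support sv mE c0 vc vE) (lee_wpmul2l _ Ed).
have {}h : (L1norm v <= (c * d)%:E)%E by rewrite EFinM; apply: h; rewrite lee_fin.
apply: (@le_trans _ _ ((k m)%:E * (c * d)%:E)%E).
  by apply: lee_wpmul2l => //; rewrite lee_fin.
rewrite -EFinM lee_fin -mulrA ler_wpM2r//.
  by rewrite -lee_fin (le_trans _ h)// L1norm_ge0.
rewrite (bigD1 (inord m))//= inordK// addrCA lerDl addr_ge0// sumr_ge0// => i _.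
by have [] := hk i.
Qed.

(** The gliding hump: if absolute continuity fails uniformly in M, functions
    with smaller and smaller supports produce a bounded function w along which
    g M w is not a Cauchy sequence. *)
Section Contradiction.
Variables (K : nat -> R) (e : R).
Hypotheses (K0 : forall M, 0 < K M) (e0 : 0 < e)
  (hK : forall m M v E (c d : R), (m <= M)%N -> step_limit v -> measurable E ->
    0 <= c -> (forall x, nrm (v x) <= c) -> (forall x, ~ E x -> v x = 0) ->
    (mu (D `&` E) <= d%:E)%E -> nrm (g m v) <= K M * c * d).
Hypothesis bad : forall d : R, 0 < d -> exists v E M,
  [/\ step_limit v, measurable E, forall x, nrm (v x) <= 1,
      forall x, ~ E x -> v x = 0 & (mu (D `&` E) <= d%:E)%E /\ e < nrm (g M v)].

(** A stage of the construction: the current function, the set on which it has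
    just been modified, the index reached so far, and the measure allotted to
    the next modification. *)
Record hump := Hump { hfun : R -> U ; hset : set R ; hidx : nat ; hmeas : R }.

(** The invariant: a measurable function bounded by one, and a positive
    allotment. *)
Definition hump_ok (s : hump) : Prop :=
  [/\ step_limit (hfun s), forall x, nrm (hfun s x) <= 1 & 0 < hmeas s].

(** One step: the function changes on a set of the allotted measure only, it
    then oscillates by more than e / 4 between the old and the new index, and the
    allotments decrease so fast that all later changes together alter g M by
    little, for M up to the new index. *)
Definition hump_next (s s' : hump) : Prop :=
  [/\ hump_ok s', measurable (hset s') /\ (mu (D `&` hset s') <= (hmeas s)%:E)%E,
      forall x, ~ hset s' x -> hfun s' x = hfun s x,
      (hidx s < hidx s')%N /\ e / 4 < nrm (g (hidx s') (hfun s') - g (hidx s) (hfun s'))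
    & hmeas s' <= hmeas s / 2 /\ K (hidx s') * 64 * hmeas s' <= e].

Lemma hump_step s : hump_ok s -> exists s', hump_next s s'.
Proof.
have ep := e0; move=> [sv v1 d0]; set v := hfun s in sv v1 *; set m := hidx s.
pose d := Num.min (hmeas s) (e / (4 * K m)).
have dp : 0 < d by rewrite lt_min d0 divr_gt0// mulr_gt0.
have [w [E [M [sw mE w1 wE [Ed eM]]]]] := bad dp.
(* the support of w is too small for the indices up to m, so the index M of w
   lies beyond m *)
have small k : (k <= m)%N -> nrm (g k w) <= e / 4.
  move=> km; have := hK km sw mE ler01 w1 wE Ed; rewrite mulr1 => h.
  rewrite (le_trans h)// (@le_trans _ _ (K m * (e / (4 * K m))))//.
    by rewrite ler_wpM2l ?ge_min ?lexx ?orbT// ltW.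
  by rewrite le_eqVlt; apply/orP; left; apply/eqP; field; rewrite gt_eqF.
have mM : (m < M)%N.
  rewrite ltnNge; apply/negP => /small; rewrite leNgt => /negP; apply.
  by apply: le_lt_trans eM; lra.
(* v with its values on E replaced by 0, or by w: these candidates va and vb
   differ by w, so one of them oscillates *)
pose va x := if x \in ~` E then v x else 0.
have sva : step_limit va by apply: step_limit_restrict => //; exact: measurableC.
have va1 x : nrm (va x) <= 1 by rewrite /va; case: ifP => _; rewrite ?nrm0.
pose vb x := va x + w x.
have svb : step_limit vb by exact: step_limitD.
have vb1 x : nrm (vb x) <= 1.
  rewrite /vb /va; case: ifPn => [/set_mem/wE ->|_]; first by rewrite addr0.
  by rewrite add0r.
have dM : 0 < Num.min (hmeas s / 2) (e / (K M * 64)).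
  by rewrite lt_min !divr_gt0// mulr_gt0.
have next v' : step_limit v' -> (forall x, nrm (v' x) <= 1) ->
    (forall x, ~ E x -> v' x = v x) -> e / 4 < nrm (g M v' - g m v') ->
    exists s', hump_next s s'.
  move=> sv' v'1 v'E h.
  exists (Hump v' E M (Num.min (hmeas s / 2) (e / (K M * 64)))); split=> //=.
    by split=> //; rewrite (le_trans Ed)// lee_fin ge_min lexx.
  split; first by rewrite ge_min lexx.
  rewrite mulrC -ler_pdivlMr ?mulr_gt0//.
  by rewrite ge_min lexx orbT.
have [ha|ha] := ltP (e / 4) (nrm (g M va - g m va)).
  by apply: (next va) => // x Ex; rewrite /va mem_set.
apply: (next vb) => // [x Ex|].
  by rewrite /vb /va mem_set// wE// addr0.
rewrite /vb !gD; try by [exact: bounded_L1fun sva va1|exact: bounded_L1fun sw w1].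
have := nrm_leD (g M w - g m w) (- (g M va - g m va)).
rewrite nrmN opprK (addrC (g M w - _)) => h1.
have := nrm_leD (g M w) (g m w); have := small m (leqnn m).
move: h1; rewrite opprD addrACA => *; lra.
Qed.

Lemma hump_sequence : exists s : nat -> hump,
  forall i, hump_ok (s i) /\ hump_next (s i) (s i.+1).
Proof.
have /choice[F hF] s : exists s', hump_ok s -> hump_next s s'.
  have [/hump_step[s' h]|h] := pselect (hump_ok s); first by exists s'.
  by exists s => /h.
pose s i := iter i F (Hump (fun=> 0) set0 0 1).
have ok i : hump_ok (s i).
  elim: i => [|i /hF[]//].
  by split=> //=; [exact: step_limit0|move=> x; rewrite nrm0].
by exists s => i; split=> //; exact/hF/ok.
Qed.

Lemma hump_contradiction : False.
Proof.
have [s hs] := hump_sequence; have ep := e0.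
pose E l := hset (s l.+1); pose v i := hfun (s i); pose d i := hmeas (s i).
have mE l : measurable (E l) by have [_ [_ []]] := hs l.
have Ed l : (mu (D `&` E l) <= (d l)%:E)%E by have [_ [_ []]] := hs l.
have vE l x : ~ E l x -> v l.+1 x = v l x by have [_ [_ _ h _ _]] := hs l; exact: h.
have d0 l : 0 < d l by have [[]] := hs l.
have dS l : d l.+1 <= d l / 2 by have [_ [_ _ _ _ []]] := hs l.
pose F i := \bigcup_(l in ~` `I_i) E l.
have mF i : measurable (F i) by apply: bigcup_measurable.
(* F i contains the points where some stage after i differs from stage i *)
have Fd i : (mu (D `&` F i) <= (2 * d i)%:E)%E.
  apply: (@le_trans _ _ (\sum_(i <= n <oo) mu (D `&` E n))%E).
    apply: measure_sigma_subadditive_tail => [n||].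
    - by apply: measurableI => //; exact: mE.
    - by apply: measurableI => //; exact: mF.
    - by rewrite /F setI_bigcupr.
  apply: lime_le; first exact: is_cvg_nneseries.
  near=> m.
  have im : (i <= m)%N by near: m; exact: nbhs_infty_ge.
  apply: (@le_trans _ _ (2 * d i - 2 * d m)%:E); last first.
    by rewrite lee_fin; have := d0 m; lra.
  rewrite -(subnKC im); elim: (m - i)%N => [|k ih].
    by rewrite addn0 big_geq// subrr.
  rewrite addnS big_nat_recr ?leq_addr//=.
  apply: (@le_trans _ _ ((2 * d i - 2 * d (i + k)%N)%:E + (d (i + k)%N)%:E)%E).
    exact: leeD.
  by rewrite -EFinD lee_fin; have := dS (i + k)%N; lra.
have vF i j x : ~ F i x -> (i <= j)%N -> v j x = v i x.
  move=> Fx /subnKC <-; elim: (j - i)%N => [|k ih]; first by rewrite addn0.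
  rewrite addnS vE// => Ex; apply: Fx; exists (i + k)%N => //=.
  by apply/negP; rewrite -leqNgt leq_addr.
pose P x i := x \notin F i.
(* the first stage after which the value at x is final; the default 0 is taken
   on the null set where there is none *)
pose k x := if pselect (exists i, P x i) is left h then ex_minn h else 0%N.
have kF x i : ~ F i x -> ~ F (k x) x /\ (k x <= i)%N.
  move=> Fx; rewrite /k; case: pselect => [h|h].
    case: ex_minnP => n /negP Pn hn; split; first by move=> /mem_set.
    by apply: hn; apply/negP => /set_mem.
  by exfalso; apply: h; exists i; apply/negP => /set_mem.
have mk n : measurable (k @^-1` [set n]).
  have mT : measurable (\bigcap_i F i) by exact: bigcapT_measurable.
  have k_least x : ~ (\bigcap_i F i) x ->
      ~ F (k x) x /\ forall i, ~ F i x -> (k x <= i)%N.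
    move=> h; have [i Fi] : exists i, ~ F i x.
      by apply/existsNP => h'; apply: h => i _; exact: h'.
    by split=> [|l Fl]; [have [] := kF _ _ Fi|have [] := kF _ _ Fl].
  have k_all x : (\bigcap_i F i) x -> k x = 0%N.
    move=> h; rewrite /k; case: pselect => // hex; exfalso.
    have [i /negP Pi] := hex.
    by apply: Pi; apply: mem_set; exact: h.
  have k_eq x : ~ (\bigcap_i F i) x -> k x = n <->
      ~ F n x /\ forall i, (i < n)%N -> F i x.
    move=> /k_least[h1 h2]; split=> [<-|[h3 h4]].
      split=> // i; rewrite ltnNge => /negP ik.
      by apply: contrapT => /h2.
    apply/eqP; rewrite eqn_leq h2//= leqNgt; apply/negP => /h4.
    exact: h1.
  pose G := (~` \bigcap_i F i) `&` (~` F n `&` \bigcap_(i in `I_n) F i).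
  have mG : measurable G.
    apply: measurableI; first exact: measurableC.
    apply: measurableI; first exact: measurableC.
    by apply: bigcap_measurableType.
  have [n0|n0] := eqVneq n 0%N.
    rewrite (_ : _ @^-1` _ = G `|` \bigcap_i F i); first exact: measurableU.
    apply/seteqP; split=> x /=.
      have [h _|h kx] := pselect ((\bigcap_i F i) x); first by right.
      by left; split=> //; apply/(k_eq x h).
    by move=> [[h1 /(k_eq x h1)]//|/k_all ->].
  rewrite (_ : _ @^-1` _ = G)//; apply/seteqP; split=> x /=.
    have [h kx|h kx] := pselect ((\bigcap_i F i) x).
      by move: n0; rewrite -kx k_all.
    by split=> //; apply/(k_eq x h).
  by move=> [h1 /(k_eq x h1)].
pose w x := v (k x) x.
have sv i : step_limit (v i) by have [[]] := hs i.
have v1 i x : nrm (v i x) <= 1 by have [[_ h _] _] := hs i; exact: h.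
have sw : step_limit w by exact: (step_limit_glue mk sv).
have w1 x : nrm (w x) <= 1 by exact: v1.
have wF i x : ~ F i x -> w x = v i x.
  by move=> Fx; have [h1 h2] := kF _ _ Fx; rewrite /w (vF (k x) i).
have [l hl] := gC sw w1.
have [|N hN] := cvg_cauchy_nrm hl (e := e / 16); first by lra.
pose n i := hidx (s i).
have nS i : (n i < n i.+1)%N by have [_ [_ _ _ []]] := hs i.
have ni i : (i <= n i)%N.
  by elim: i => // i ih; rewrite (leq_ltn_trans ih).
have h1 := hN _ _ (ni N) (leq_trans (ni N) (ltnW (nS N))).
have h2 : e / 4 < nrm (g (n N.+1) (v N.+1) - g (n N) (v N.+1)).
  by have [_ [_ _ _ []]] := hs N.
have Kd : K (n N.+1) * 64 * d N.+1 <= e by have [_ [_ _ _ _ []]] := hs N.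
have sNv : step_limit (fun x => - v N.+1 x) by exact: step_limitN.
have Nv1 x : nrm (- v N.+1 x) <= 1 by rewrite nrmN.
have close m : (m <= n N.+1)%N -> nrm (g m w - g m (v N.+1)) <= e / 16.
  move=> mn.
  have gN : g m (fun x => - v N.+1 x) = - g m (v N.+1).
    have g0 : g m (fun=> 0 : U) = 0.
      apply: (addrI (g m (fun=> 0))); rewrite addr0 -gD.
      + by congr (g m _); apply/funext => x; rewrite addr0.
      + by apply: (bounded_L1fun (c := 0)) => [|x]; [exact: step_limit0|rewrite nrm0].
      + by apply: (bounded_L1fun (c := 0)) => [|x]; [exact: step_limit0|rewrite nrm0].
    apply/eqP; rewrite -addr_eq0 -gD; last 2 first.
    - exact: bounded_L1fun Nv1.
    - exact: bounded_L1fun (v1 _).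
    rewrite (_ : (fun x => _) = (fun=> 0)) ?g0//.
    by apply/funext => x; rewrite addNr.
  rewrite -gN -gD; last 2 first.
  - exact: bounded_L1fun w1.
  - exact: bounded_L1fun Nv1.
  have -> : e / 16 = e / 64 * 2 * 2 by field.
  have u2 x : nrm (w x + - v N.+1 x) <= 2.
    by rewrite (le_trans (nrmD _ _))// (le_trans (lerD (w1 x) (Nv1 x))).
  have uF x : ~ F N.+1 x -> w x + - v N.+1 x = 0 by move=> /wF ->; rewrite subrr.
  rewrite (le_trans (hK mn (step_limitD sw sNv) (mF _) _ u2 uF (Fd _)))//.
  by have := Kd; lra.
have c1 := close _ (leqnn _); have c2 := close _ (ltnW (nS N)).
move: h1; rewrite nrmBC => h1.
have := nrm_leD (g (n N.+1) (v N.+1) - g (n N) (v N.+1)) (g (n N.+1) w - g (n N) w).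
rewrite (_ : _ - _ - _ = (g (n N) w - g (n N) (v N.+1)) -
    (g (n N.+1) w - g (n N.+1) (v N.+1))); last first.
  by rewrite !opprB addrACA [in RHS]addrC [RHS]addrACA; congr (_ + _); rewrite addrC.
have := nrmB (g (n N) w - g (n N) (v N.+1)) (g (n N.+1) w - g (n N.+1) (v N.+1)).
lra.
Unshelve. all: by end_near. Qed.

End Contradiction.

(** In the spirit of the Vitali-Hahn-Saks theorem: additive maps g M, continuous
    for the norm of L^1 and converging on bounded functions, are uniformly small
    on the functions bounded by one that vanish off a small set. *)
Lemma uniform_absolute_continuity (e : R) : 0 < e -> exists2 d : R, 0 < d &
  forall v E, step_limit v -> measurable E -> (forall x, nrm (v x) <= 1) ->
    (forall x, ~ E x -> v x = 0) -> (mu (D `&` E) <= d%:E)%E ->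
  forall M, nrm (g M v) <= e.
Proof.
move=> e0; have [K [K0 hK]] := uniform_support_bound.
apply: contrapT => h; apply: (hump_contradiction K0 e0 hK) => d d0.
apply: contrapT => h'; apply: h; exists d => // v E sv mE v1 vE Ed M.
rewrite leNgt; apply/negP => h''; apply: h'; exists v, E, M.
by split.
Qed.

End GlidingHump.

(** * Summation over level sets *)

Section LevelSets.
Context {R : realType}.
Local Notation mu := (@lebesgue_measure R).
Variable D : set R.
Hypotheses (mD : measurable D) (fD : (mu D < +oo)%E).
Context {U : normedModType R[i]} {X : completeNormedModType R[i]}.
Variable g : nat -> (R -> U) -> X.

Local Notation L1norm f := (\int[mu]_(x in D) (nrm (f x))%:E)%E.

Hypothesis gD : forall M v w, L1fun D v -> L1fun D w ->
  g M (fun x => v x + w x) = g M v + g M w.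
Hypothesis gZ : forall M a v, L1fun D v ->
  g M (fun x => a *: v x) = a *: g M v.
Hypothesis gK : forall M, exists2 K : R, 0 <= K &
  forall v, L1fun D v -> ((nrm (g M v))%:E <= K%:E * L1norm v)%E.
Hypothesis gC : forall v (c : R), step_limit v -> (forall x, nrm (v x) <= c) ->
  exists l : X, g M v @[M --> \oo] --> l.

Lemma L1fun_restrict (u : R -> U) (E : set R) : measurable E -> L1fun D u ->
  L1fun D (fun x => if x \in E then u x else 0).
Proof.
move=> mE [su iu]; split; first exact: step_limit_restrict.
apply: le_lt_trans iu; apply: L1norm_le => //; first exact: step_limit_restrict.
by move=> x _; case: ifP => _; rewrite ?nrm0 ?nrm_ge0.
Qed.

Lemma L1norm_tail_cvg0 (u : R -> U) (A : nat -> set R) :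
  (forall j, measurable (A j)) -> L1fun D u ->
  (forall x, \forall j \near \oo, ~ A j x) ->
  L1norm (fun x => if x \in A j then u x else 0) @[j --> \oo] --> 0%E.
Proof.
move=> mA [su iu] Ax.
have [|||||_ _] := @dominated_convergence _ _ _ mu D mD
  (fun j x => (nrm (if x \in A j then u x else 0))%:E) (fun=> 0%E)
  (fun x => (nrm (u x))%:E).
- by move=> j; apply: step_limit_nrm_measurable => //; exact: step_limit_restrict.
- exact: measurable_cst.
- apply: aeW => x Dx; apply: cvg_near_cst; apply: filterS (Ax x) => j Ajx.
  by rewrite memNset// nrm0.
- apply/integrableP; split; first exact: step_limit_nrm_measurable.
  apply: le_lt_trans iu; rewrite le_eqVlt; apply/orP; left; apply/eqP.
  by apply: eq_integral => x _; rewrite abse_EFin ger0_norm// nrm_ge0.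
- apply: aeW => x j Dx; rewrite abse_EFin ger0_norm ?nrm_ge0// lee_fin.
  by case: ifP => _; rewrite ?nrm0 ?nrm_ge0.
- by rewrite integral0.
Qed.

(** Convergence of g M u for an unbounded u.  The layer of u where its norm lies
    between 2 j and 2 (j + 1) contributes at most 2^-j, uniformly in M, once
    functions bounded by one that live on the superlevel set at 2 j are sent
    below 2^-j / (2 (j + 1)). *)
Lemma level_sets_cvg (u : R -> U) (J0 : nat) : L1fun D u ->
  (forall j, (J0 <= j)%N -> forall v, step_limit v ->
    (forall x, nrm (v x) <= 1) ->
    (forall x, ~ (j.*2%:R <= nrm (u x)) -> v x = 0) ->
    forall M, nrm (g M v) <= 2^-1 ^+ j / j.+1.*2%:R) ->
  exists l : X, g M u @[M --> \oo] --> l.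
Proof.
move=> Lu hsmall; have [su iu] := Lu.
pose A j := [set x | j.*2%:R <= nrm (u x)].
have mA j : measurable (A j) by exact: measurable_superlevel.
(* the tail of u above level 2 j *)
pose w j x := if x \in A j then u x else 0.
have Lw j : L1fun D (w j) by exact: L1fun_restrict.
have hp j M : (J0 <= j)%N ->
    nrm (g M (fun x => if x \in A j `\` A j.+1 then u x else 0)) <= 2^-1 ^+ j.
  move=> Jj; have mE : measurable (A j `\` A j.+1) by exact: measurableD.
  pose p x := if x \in A j `\` A j.+1 then u x else 0.
  have Lp : L1fun D p by exact: L1fun_restrict.
  have c0 : 0 < j.+1.*2%:R :> R by rewrite ltr0n double_gt0.
  have px x : nrm (p x) <= j.+1.*2%:R.
    rewrite /p; case: ifPn => [/set_mem[_ /negP]|_]; last by rewrite nrm0 ltW.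
    by rewrite -ltNge => /ltW.
  pose c : R[i] := ((j.+1.*2%:R)^-1)%:C.
  have nc : nrm c = (j.+1.*2%:R)^-1 by rewrite nrmR ger0_norm// invr_ge0 ltW.
  have h1 x : nrm (c *: p x) <= 1.
    by rewrite nrmZ nc mulrC ler_pdivrMr// mul1r.
  have h2 x : ~ (j.*2%:R <= nrm (u x)) -> c *: p x = 0.
    by move=> Ax; rewrite /p memNset ?scaler0// => -[].
  have := hsmall j Jj _ (step_limitZ c Lp.1) h1 h2 M.
  by rewrite gZ// nrmZ nc mulrC ler_pdivrMr// divfK ?gt_eqF.
have tail M J : (J0 <= J)%N -> nrm (g M (w J)) <= 2 * 2^-1 ^+ J.
  move=> JJ; have step k : nrm (g M (w J)) <=
      2 * 2^-1 ^+ J - 2 * 2^-1 ^+ (J + k) + nrm (g M (w (J + k)%N)).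
    elim: k => [|k ih]; first by rewrite addn0 subrr add0r.
    rewrite (le_trans ih)// addnS.
    have -> : w (J + k)%N = (fun x =>
        (if x \in A (J + k)%N `\` A (J + k).+1 then u x else 0) + w (J + k).+1 x).
      apply/funext => x; rewrite /w.
      have [h|h] := pselect (A (J + k).+1 x).
        have h' : A (J + k)%N x.
          by apply: le_trans h; rewrite ler_nat leq_double.
        by rewrite (mem_set h) (mem_set h') memNset ?add0r// => -[].
      rewrite (memNset h) addr0.
      have [h'|h'] := pselect (A (J + k)%N x); first by rewrite !mem_set.
      by rewrite !memNset// => -[].
    rewrite gD//; last by apply: L1fun_restrict => //; exact: measurableD.
    have h1 := hp (J + k)%N M (leq_trans JJ (leq_addr _ _)).
    have h2 := nrmD (g M (fun x => if x \in A (J + k)%N `\` A (J + k).+1 then u x else 0))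
      (g M (w (J + k).+1)).
    rewrite exprS; lra.
  apply/ler_addgt0Pr => e e0; have [K K0 hK] := gK M.
  have K1 : 0 < K + 1 by lra.
  have tl : \forall j \near \oo, (L1norm (w j) < (e / (K + 1))%:E)%E.
    apply: cvge0_small; first by rewrite divr_gt0.
    apply: L1norm_tail_cvg0 => // x.
    exists (Num.truncn (nrm (u x))).+1 => // j /= hj; rewrite /A/=; apply/negP.
    rewrite -ltNge (lt_le_trans (truncnS_gt _))// ler_nat (leq_trans hj)//.
    by rewrite -addnn leq_addr.
  have [N _ hN] := tl.
  have JN : (N <= J + N)%N by rewrite leq_addl.
  have h1 : nrm (g M (w (J + N)%N)) <= e.
    rewrite -lee_fin (le_trans (hK _ (Lw _)))//.
    rewrite (le_trans (lee_wpmul2l _ (ltW (hN _ JN))))// ?lee_fin//.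
    rewrite mulrCA ger_pMr// ler_pdivrMr// mul1r; lra.
  have h2 : 0 <= (2^-1 : R) ^+ (J + N) by rewrite exprn_ge0.
  have := step N; lra.
apply: cauchy_nrm_cvg => e e0.
have [J [JJ hJ]] : exists J, (J0 <= J)%N /\ 2 * (2^-1 : R) ^+ J < e / 4.
  have /cvgrPdist_lt/(_ (e / 8)) : (fun n => (2^-1 : R) ^+ n) @ \oo --> 0.
    by apply: cvg_expr; rewrite ger0_norm// invf_lt1 ?ltr1n.
  move=> [|N _ hN]; first by rewrite divr_gt0.
  exists (maxn J0 N); split; first exact: leq_maxl.
  have := hN _ (leq_maxr J0 N); rewrite sub0r normrN ger0_norm ?exprn_ge0// => h.
  by lra.
pose b x := if x \in ~` A J then u x else 0.
have mC : measurable (~` A J) by exact: measurableC.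
have sb : step_limit b by exact: step_limit_restrict.
have b2 x : nrm (b x) <= J.*2%:R.
  rewrite /b; case: ifPn => [/set_mem/negP|_]; last by rewrite nrm0.
  by rewrite -ltNge => /ltW.
have [l hl] := gC sb b2.
have e2 : 0 < e / 2 by rewrite divr_gt0.
have [N hN] := cvg_cauchy_nrm hl e2.
have uE : u = (fun x => b x + w J x).
  apply/funext => x; rewrite /b /w; have [h|h] := pselect (A J x).
    by rewrite (mem_set h) memNset ?add0r//; apply.
  by rewrite (memNset h) mem_set// addr0.
exists N => n m Nn Nm; rewrite uE !gD//; try exact: L1fun_restrict.
have h1 := hN n m Nn Nm; have h2 := tail n J JJ; have h3 := tail m J JJ.
rewrite opprD addrACA (le_lt_trans (nrmD _ _))//.
have := nrmB (g n (w J)) (g m (w J)); lra.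
Qed.

End LevelSets.

(** * An N-function of prescribed growth *)

Section NFunction.
Context {R : realType}.
Local Notation mu := (@lebesgue_measure R).
Variable d : nat -> R.
Hypothesis d0 : forall j, 0 < d j.

(* a nondecreasing sequence, at least 1 and with j-th term at least 1 / d j *)
Let c (n : nat) : R := 1 + \sum_(i < n.+1) (d i)^-1.

Let c_ge1 n : 1 <= c n.
Proof. by rewrite /c lerDl sumr_ge0// => i _; rewrite invr_ge0 ltW. Qed.

Let c_homo m n : (m <= n)%N -> c m <= c n.
Proof.
move=> /subnKC <-; elim: (n - m)%N => [|k ih]; first by rewrite addn0.
rewrite (le_trans ih)// addnS /c lerD2l [leRHS]big_ord_recr/= lerDl.
by rewrite invr_ge0 ltW.
Qed.

Let c_ge j : (d j)^-1 <= c j.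
Proof.
rewrite /c big_ord_recr/= addrA lerDr addr_ge0// sumr_ge0// => i _.
by rewrite invr_ge0 ltW.
Qed.

(* the density s * c n for n - 1 < s <= n, which is left-continuous and
   nondecreasing *)
Let phi (s : R) : R := Num.max 0 s * c (absz (Num.ceil (Num.max 0 s))).

Let phi_ge0 s : 0 <= phi s.
Proof. by rewrite mulr_ge0 ?le_max ?lexx// (le_trans _ (c_ge1 _)). Qed.

Let phi_homo : {homo phi : s t / s <= t}.
Proof.
move=> s t st; have m : Num.max 0 s <= Num.max 0 t.
  by rewrite ge_max !le_max lexx st orbT.
have m0 r : 0 <= Num.max 0 r :> R by rewrite le_max lexx.
apply: ler_pM => //; first by rewrite (le_trans _ (c_ge1 _)).
apply: c_homo; rewrite -lez_nat !gez0_abs ?ceil_ge0 ?le_ceil//.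
- by rewrite (lt_le_trans _ (m0 _))// ltrN10.
- by rewrite (lt_le_trans _ (m0 _))// ltrN10.
Qed.

Let phi_pos s (n : nat) : n%:R - 1 < s -> 0 < s -> s <= n%:R -> phi s = s * c n.
Proof.
move=> ns s0 sn; rewrite /phi (max_idPr (ltW s0)).
by have -> : Num.ceil s = n%:Z by apply: ceil_def; rewrite intrB; apply/andP.
Qed.

Let phi_le1 s : 0 < s -> s <= 1 -> phi s = s * c 1.
Proof. by move=> s0 s1; apply: phi_pos; rewrite ?subrr. Qed.

Let phi_nat (n : nat) : (0 < n)%N -> phi n%:R = n%:R * c n.
Proof. by move=> n0; apply: phi_pos; rewrite ?ltr0n// ltrBlDr ltrDl. Qed.

Let phi_ge s : 0 <= s -> s <= phi s.
Proof. by move=> s0; rewrite /phi (max_idPr s0) ler_peMr. Qed.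

Let measurable_phi : measurable_fun setT phi.
Proof. exact: nondecreasing_measurable. Qed.

Let phi_left_continuous t : 0 < t -> phi s @[s --> t^'-] --> phi t.
Proof.
move=> t0; pose n := `|Num.ceil t|%N.
have nE : n%:R = (Num.ceil t)%:~R :> R.
  by rewrite -[LHS]/((n%:Z)%:~R) gez0_abs// ceil_ge0 (lt_trans _ t0)// ltrN10.
have /andP[n1 n2] : n%:R - 1 < t <= n%:R by rewrite nE -[1]/(1%:~R) -intrB; exact: ceil_itv.
have h : s * c n @[s --> t^'-] --> t * c n.
  by apply: cvg_at_left_filter; apply: cvgM; [exact: cvg_id|exact: cvg_cst].
rewrite (phi_pos n1 t0 n2); apply: cvg_trans h; apply: near_eq_cvg.
near=> s; apply/esym/phi_pos.
- by near: s; exact: nbhs_left_gt.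
- by near: s; exact: nbhs_left_gt.
- by rewrite (le_trans _ n2)//; near: s; exact: nbhs_left_le.
Unshelve. all: by end_near. Qed.

(** An N-function growing at least like j ^ 2 / d j along the points 2 j; it is
    0 at negative reals. *)
Definition Nfun (t : R) : R := fine (\int[mu]_(s in `[0%R, t]) (phi s)%:E)%E.

Let mphi D : measurable D -> measurable_fun D (EFin \o phi).
Proof. by move=> mD; apply/measurable_EFinP; exact: measurable_funS measurable_phi. Qed.

Let integral_phi_le t : 0 <= t ->
  (\int[mu]_(s in `[0%R, t]) (phi s)%:E <= (phi t * t)%:E)%E.
Proof.
move=> t0.
apply: (@le_trans _ _ (\int[mu]_(s in `[0%R, t]) (phi t)%:E)%E).
  apply: ge0_le_integral => //.
  - by move=> x _; rewrite lee_fin.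
  - exact: mphi.
  - by move=> x /=; rewrite in_itv/= => /andP[_ xt]; rewrite lee_fin phi_homo.
rewrite integral_cst//= lebesgue_measure_itv/= lte_fin.
case: ifP => _; first by rewrite -EFinD subr0 -EFinM.
by rewrite mule0 lee_fin mulr_ge0.
Qed.

Let NfunE t : 0 <= t ->
  (Nfun t)%:E = (\int[mu]_(s in `[0%R, t]) (phi s)%:E)%E.
Proof.
move=> t0; rewrite /Nfun fineK// ge0_fin_numE.
  by rewrite (le_lt_trans (integral_phi_le t0))// ltry.
by apply: integral_ge0 => x _; rewrite lee_fin.
Qed.

Lemma Nfun_ge0 t : 0 <= Nfun t.
Proof. by apply: fine_ge0; apply: integral_ge0 => x _; rewrite lee_fin. Qed.

Let Nfun_le t : 0 <= t -> Nfun t <= phi t * t.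
Proof. by move=> t0; rewrite -lee_fin NfunE// integral_phi_le. Qed.

Let Nfun_ge t : 0 <= t -> phi (t / 2) * (t / 2) <= Nfun t.
Proof.
move=> t0; rewrite -lee_fin NfunE//.
have sub : `[t / 2, t]%classic `<=` `[0, t]%classic.
  by move=> x /=; rewrite !in_itv/=; lra.
apply: (@le_trans _ _ (\int[mu]_(s in `[(t / 2)%R, t]) (phi s)%:E)%E); last first.
  apply: ge0_subset_integral => //.
  - exact: mphi.
  - by move=> x _; rewrite lee_fin.
apply: (@le_trans _ _ (\int[mu]_(s in `[(t / 2)%R, t]) (phi (t / 2))%:E)%E).
  rewrite integral_cst//= lebesgue_measure_itv/= lte_fin.
  case: ltP => h; last by rewrite mule0 lee_fin (_ : t / 2 = 0) ?mulr0//; lra.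
  by rewrite -EFinD -EFinM lee_fin ler_wpM2l//; lra.
apply: ge0_le_integral => //.
- by move=> x _; rewrite lee_fin.
- exact: mphi.
- by move=> x /=; rewrite in_itv/= => /andP[tx _]; rewrite lee_fin phi_homo.
Qed.

Lemma Nfun0 : Nfun 0 = 0.
Proof.
by apply/eqP; rewrite eq_le Nfun_ge0 andbT; have := Nfun_le (lexx 0); rewrite mulr0.
Qed.

Lemma Nfun_homo : {homo Nfun : s t / s <= t}.
Proof.
move=> s t st; have [s0|s0] := ltP s 0.
  rewrite {1}/Nfun set_itv_ge ?integral_set0 ?Nfun_ge0// bnd_simp -ltNge//.
have t0 := le_trans s0 st.
rewrite -lee_fin !NfunE//; apply: ge0_subset_integral => //.
- exact: mphi.
- by move=> x _; rewrite lee_fin.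
- by move=> x /=; rewrite !in_itv/= => /andP[-> /le_trans ->].
Qed.

Lemma Nfun_even j : (0 < j)%N -> j%:R ^+ 2 / d j <= Nfun j.*2%:R.
Proof.
move=> j0; have := @Nfun_ge j.*2%:R (ler0n _ _).
have -> : j.*2%:R / 2 = j%:R :> R by rewrite -mul2n natrM mulrC mulKf.
by apply: le_trans; rewrite phi_nat// [leRHS]mulrAC -expr2 ler_wpM2l ?exprn_ge0 ?c_ge.
Qed.

Lemma Nfun_superlinear x : 0 <= x -> x <= 2 + 2 * Nfun x.
Proof.
move=> x0; have := Nfun_ge0 x; have := Nfun_ge x0.
have := @phi_ge (x / 2); rewrite divr_ge0// => /(_ isT) h1 h2 h3.
have h4 : x / 2 * (x / 2) <= Nfun x.
  by rewrite (le_trans _ h2)// ler_wpM2r// divr_ge0.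
have [x2|x2] := leP x 2; first lra.
nra.
Qed.

Lemma Nfun_N_function : N_function Nfun.
Proof.
split.
- exists (EFin \o phi); split.
  + by split=> [s _|s t _ st]; rewrite /= lee_fin ?phi_homo.
  + move=> t t0; apply: cvg_EFin; first exact: nearW.
    exact: phi_left_continuous.
  + by exists 1; rewrite //= phi_le1// mul1r eqe gt_eqF// (lt_le_trans _ (c_ge1 _)).
  + by exists 0.
  + by move=> t t0; rewrite NfunE.
- apply/cvgrPdist_le => e e0; have c1 : 0 < c 1 by rewrite (lt_le_trans _ (c_ge1 _)).
  near=> x.
  have x0 : 0 < x by near: x; exact: nbhs_right_gt.
  have x1 : x <= 1 by near: x; exact: nbhs_right_le.
  have xe : x <= e / c 1 by near: x; apply: nbhs_right_le; rewrite divr_gt0.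
  rewrite sub0r normrN ger0_norm ?(divr_ge0 (Nfun_ge0 _) (ltW x0))// ler_pdivrMr//.
  rewrite (le_trans (Nfun_le (ltW x0)))// ler_pM2r// phi_le1//.
  by rewrite -ler_pdivlMr.
- apply/cvgrPdist_le => e e0; near=> x.
  have x0 : 0 < x by near: x; exact: nbhs_pinfty_gt.
  have xe : 4 / e <= x by near: x; apply: nbhs_pinfty_ge; rewrite num_real.
  have h : x / 2 * (x / 2) <= Nfun x.
    have x2 : 0 <= x / 2 by lra.
    by rewrite (le_trans _ (Nfun_ge (ltW x0)))// ler_wpM2r// phi_ge.
  have N0 : 0 < Nfun x by rewrite (lt_le_trans _ h)// mulr_gt0// divr_gt0.
  rewrite sub0r normrN ger0_norm ?(divr_ge0 (ltW x0) (ltW N0))// ler_pdivrMr//.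
  rewrite (le_trans _ (ler_wpM2l (ltW e0) h))//.
  rewrite ler_pdivrMr// in xe; nra.
Unshelve. all: by end_near. Qed.

End NFunction.

(** * The input map *)

Section InputMap.
Context {R : realType} (X1 : completeNormedModType R[i]) (U : normedModType R[i]).
Local Notation mu := (@lebesgue_measure R).
Variables (T1 : R -> X1 -> X1) (B : U -> X1) (N : R).
Hypotheses (bB : bounded_linear B) (N0 : 0 <= N).
Hypothesis bT : forall t, 0 <= t -> bounded_linear (T1 t).
Hypothesis T1_bound : exists2 M : R, 0 <= M &
  forall t y, 0 <= t -> t <= N -> nrm (T1 t y) <= M * nrm y.
Hypothesis T1D : forall s t y, 0 <= s -> 0 <= t -> T1 (s + t) y = T1 s (T1 t y).
Hypothesis T1c : forall y e, 0 < e -> exists2 d : R, 0 < d &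
  forall h, 0 <= h -> h < d -> nrm (T1 h y - y) < e.

Local Notation D := (`]0, N[%classic).
Local Notation L1norm f := (\int[mu]_(x in D) (nrm (f x))%:E)%E.

(** The integrand of the input map for the control v read backwards in time,
    which makes it independent of the final time; the projection onto [0, N] only
    serves to define it on the whole line. *)
Definition integrand (v : R -> U) (s : R) : X1 := T1 (clip N s) (B (v s)).

Let fD : (mu D < +oo)%E.
Proof. by rewrite lebesgue_measure_itv/=; case: ifP => _; rewrite -?EFinB ltry. Qed.

Let mD : measurable D. Proof. exact: measurable_itv. Qed.

Lemma integrand_step_limit v : step_limit v -> step_limit (integrand v).
Proof.
move=> sv; have [M M0 hM] := T1_bound.
apply: (step_limit_orbit N0 M0 _ hM T1D T1c) => [t t0|].
  by have [] := bT t0.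
exact: (step_limit_comp bB sv).
Qed.

Lemma integrandD v w s : integrand (fun x => v x + w x) s = integrand v s + integrand w s.
Proof.
rewrite /integrand (mapD_linear bB.1).
by rewrite (mapD_linear (bT (clip_ge0 N s)).1).
Qed.

Lemma integrandZ a v s : integrand (fun x => a *: v x) s = a *: integrand v s.
Proof.
rewrite /integrand (mapZ_linear _ bB.1).
by rewrite (mapZ_linear _ (bT (clip_ge0 N s)).1).
Qed.

Lemma integrand_bound : exists2 K : R, 0 <= K &
  forall v s, nrm (integrand v s) <= K * nrm (v s).
Proof.
have [M M0 hM] := T1_bound; have [L L0 hL] := bounded_linear_ge0 bB.
exists (M * L) => [|v s]; first exact: mulr_ge0.
rewrite (le_trans (hM _ _ (clip_ge0 N s) (clip_le s N0)))// -mulrA ler_wpM2l//.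
Qed.

Lemma integrand_L1norm : exists2 K : R, 0 <= K &
  forall v, L1fun D v -> (L1norm (integrand v) <= K%:E * L1norm v)%E.
Proof.
have [K K0 hK] := integrand_bound; exists K => // v [sv iv].
have nK : nrm K%:C = K by rewrite nrmR ger0_norm.
rewrite -{1}nK -L1normZ//; apply: L1norm_le => //.
- exact: integrand_step_limit.
- exact: step_limitZ.
- by move=> x _; rewrite nrmZ nK.
Qed.

(** The Bochner integral of the orbit driven by v over the time interval. *)
Definition input_map (v : R -> U) : X1 :=
  xget 0 [set y | has_bochner_integral D (integrand v) y].

Lemma input_mapP v : L1fun D v ->
  has_bochner_integral D (integrand v) (input_map v).
Proof.
move=> Lv; have [sv iv] := Lv; have [K K0 hK] := integrand_L1norm.
have [||y hy] := @step_limit_bochner _ _ mD fD _ (integrand v).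
- exact: integrand_step_limit.
- by rewrite (le_lt_trans (hK _ Lv))// lte_mul_pinfty.
- by rewrite /input_map; case: xgetP => [z _ //|/(_ y)].
Qed.

Lemma input_map_unique v y : L1fun D v ->
  has_bochner_integral D (integrand v) y -> input_map v = y.
Proof.
move=> Lv hy; apply: (has_bochner_integral_unique mD fD _ (input_mapP Lv) hy).
by apply: integrand_step_limit; case: Lv.
Qed.

Lemma L1funD (v w : R -> U) : L1fun D v -> L1fun D w -> L1fun D (fun x => v x + w x).
Proof.
move=> [sv iv] [sw iw]; split; first exact: step_limitD.
rewrite (@le_lt_trans _ _ (L1norm v + L1norm w)%E)//; last exact: lte_add_pinfty.
by apply: L1norm_leD => //; [exact: step_limitD|move=> x; exact: nrmD].
Qed.

Lemma L1funZ a (v : R -> U) : L1fun D v -> L1fun D (fun x => a *: v x).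
Proof.
move=> [sv iv]; split; first exact: step_limitZ.
by rewrite L1normZ// lte_mul_pinfty// lee_fin nrm_ge0.
Qed.

Lemma input_mapD v w : L1fun D v -> L1fun D w ->
  input_map (fun x => v x + w x) = input_map v + input_map w.
Proof.
move=> Lv Lw; apply: input_map_unique; first exact: L1funD.
rewrite (_ : integrand _ = (fun s => integrand v s + integrand w s)).
  by apply: has_bochner_integralD => //; try exact: input_mapP;
    apply: integrand_step_limit; [case: Lv|case: Lw].
by apply/funext => s; exact: integrandD.
Qed.

Lemma input_mapZ a v : L1fun D v ->
  input_map (fun x => a *: v x) = a *: input_map v.
Proof.
move=> Lv; apply: input_map_unique; first exact: L1funZ.
rewrite (_ : integrand _ = (fun s => a *: integrand v s)).
  apply: has_bochner_integralZ => //; last exact: input_mapP.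
  by apply: integrand_step_limit; case: Lv.
by apply/funext => s; exact: integrandZ.
Qed.

Lemma input_map_bound : exists2 K : R, 0 <= K &
  forall v, L1fun D v -> ((nrm (input_map v))%:E <= K%:E * L1norm v)%E.
Proof.
have [K K0 hK] := integrand_L1norm; exists K => // v Lv.
apply: le_trans (hK v Lv).
apply: (has_bochner_integral_norm mD fD _ (input_mapP Lv)).
by apply: integrand_step_limit; case: Lv.
Qed.

(** Bounded controls are steered into the range of j, by admissibility applied
    to the control read forwards in time. *)
Lemma input_map_bounded_range (X : normedModType R[i]) (j : X -> X1) v (c : R) :
  0 < N -> admissible j T1 (@L_infty R U) B -> step_limit v ->
  (forall x, nrm (v x) <= c) -> exists x, j x = input_map v.
Proof.
move=> Np [_ adm] sv vc.
have Lv : L1fun D v by exact: bounded_L1fun vc.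
pose u s := v (N - s).
have [|x hx] := adm N Np u.
  have [s [ss su]] := step_limit_reflect N sv.
  split; first by exists s; split=> //; apply: aeW => w _; exact: su.
  by exists c; apply: aeW => s0 _; exact: vc.
exists x; apply/esym.
have si := integrand_step_limit sv.
have h1 := has_bochner_integral_reflect si (input_mapP Lv).
have h2 : has_bochner_integral D (fun s => integrand v (N - s)) (j x).
  apply: has_bochner_integral_ae hx; apply: aeW => s /=; rewrite in_itv/= => /andP[s0 sN].
  by rewrite /integrand clip_id//; lra.
exact: (has_bochner_integral_unique mD fD (step_limit_reflect N si) h1 h2).
Qed.

End InputMap.

(** * Admissibility for an Orlicz space *)

Section Admissibility.
Context {R : realType} (q : R) (X : completeNormedModType R[i])
  (phi : int -> X) (A : operator X) (T : R -> X -> X)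
  (X1 : completeNormedModType R[i]) (j : X -> X1) (T1 : R -> X1 -> X1)
  (U : normedModType R[i]) (B : U -> X1).
Local Notation mu := (@lebesgue_measure R).
Hypotheses (q0 : 0 < q) (rb : riesz_basis q phi)
  (gd : generates_diagonal phi A T) (ex : extrapolation A T j T1)
  (adm : admissible j T1 (@L_infty R U) B).

Let bB : bounded_linear B. Proof. by have [] := adm. Qed.
Let bT t : 0 <= t -> bounded_linear (T1 t).
Proof. by have [_ _ _ h] := ex; move=> t0; have [] := h t t0. Qed.
Let TD : forall s t y, 0 <= s -> 0 <= t -> T1 (s + t) y = T1 s (T1 t y).
Proof. by move=> s t y; exact: (extrapolation_TD gd ex). Qed.
Let Tc : forall y e, 0 < e -> exists2 d : R, 0 < d &
  forall h, 0 <= h -> h < d -> nrm (T1 h y - y) < e.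
Proof. by move=> y e; exact: (extrapolation_continuous0 q0 rb gd ex). Qed.
Let Tb N := extrapolation_bound q0 rb gd ex N.

Local Notation window N := (`]0, N[%classic).

Let fdom (N : R) : (mu (window N) < +oo)%E.
Proof. by rewrite lebesgue_measure_itv/=; case: ifP => _; rewrite -?EFinB ltry. Qed.

Let mdom (N : R) : measurable (window N). Proof. exact: measurable_itv. Qed.

(** Q stands for the partial expansions provided by range_expansion. *)
Section Expansion.
Variables (Q : nat -> X1 -> X) (N : R).
Hypotheses (bQ : forall M, bounded_linear (Q M))
  (jQ : forall y, (exists x, j x = y) <-> exists x : X, Q M y @[M --> \oo] --> x)
  (Np : 0 < N).

Let N0 : 0 <= N. Proof. exact: ltW. Qed.

Let g M v := Q M (input_map T1 B N v).

Let gD M v w : L1fun (window N) v -> L1fun (window N) w ->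
  g M (fun x => v x + w x) = g M v + g M w.
Proof.
by move=> Lv Lw; rewrite /g (input_mapD bB N0 bT (Tb N) TD Tc)// (mapD_linear (bQ M).1).
Qed.

Let gZ M a v : L1fun (window N) v -> g M (fun x => a *: v x) = a *: g M v.
Proof.
by move=> Lv; rewrite /g (input_mapZ bB N0 bT (Tb N) TD Tc)// (mapZ_linear _ (bQ M).1).
Qed.

Let gK M : exists2 K : R, 0 <= K & forall v, L1fun (window N) v ->
  ((nrm (g M v))%:E <= K%:E * \int[mu]_(x in window N) (nrm (v x))%:E)%E.
Proof.
have [K K0 hK] := input_map_bound bB N0 bT (Tb N) TD Tc.
have [L L0 hL] := bounded_linear_ge0 (bQ M).
exists (L * K) => [|v Lv]; first exact: mulr_ge0.
apply: (@le_trans _ _ (L%:E * (nrm (input_map T1 B N v))%:E)%E).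
  by rewrite -EFinM lee_fin; exact: hL.
by rewrite EFinM -muleA; apply: lee_wpmul2l; rewrite ?lee_fin//; exact: hK.
Qed.

Let gC v (c : R) : step_limit v -> (forall x, nrm (v x) <= c) ->
  exists l : X, g M v @[M --> \oo] --> l.
Proof.
move=> sv vc; apply/jQ.
exact: (input_map_bounded_range bB N0 bT (Tb N) TD Tc Np adm sv vc).
Qed.

Lemma expansion_absolute_continuity (e : R) : 0 < e -> exists2 d : R, 0 < d &
  forall v E, step_limit v -> measurable E -> (forall x, nrm (v x) <= 1) ->
    (forall x, ~ E x -> v x = 0) -> (mu (window N `&` E) <= d%:E)%E ->
  forall M, nrm (Q M (input_map T1 B N v)) <= e.
Proof. exact: (uniform_absolute_continuity (mdom N) (fdom N) gD gK gC). Qed.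

Lemma level_sets_range u (J0 : nat) : L1fun (window N) u ->
  (forall i, (J0 <= i)%N -> forall v, step_limit v ->
    (forall x, nrm (v x) <= 1) ->
    (forall x, ~ (i.*2%:R <= nrm (u x)) -> v x = 0) ->
    forall M, nrm (Q M (input_map T1 B N v)) <= 2^-1 ^+ i / i.+1.*2%:R) ->
  exists x, j x = input_map T1 B N u.
Proof.
move=> Lu hu; apply/jQ.
exact: (level_sets_cvg (mdom N) gD gZ gK gC Lu hu).
Qed.

End Expansion.

(** A control vanishing off a subinterval has the same integral over it. *)
Lemma has_bochner_integral_sub (t0 N : R) (v : R -> U) y : 0 < t0 -> t0 <= N ->
  L1fun (window N) v -> (forall x, ~ window t0 x -> v x = 0) ->
  has_bochner_integral (window N) (integrand T1 B N v) y ->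
  has_bochner_integral (window t0) (integrand T1 B N v) y.
Proof.
move=> t0p tN Lv v0 hy.
have N0 : 0 <= N by rewrite (le_trans _ tN)// ltW.
have sub : window t0 `<=` window N.
  by move=> x /=; rewrite !in_itv/= => /andP[-> /lt_le_trans ->].
have sf : step_limit (integrand T1 B N v).
  by apply: (integrand_step_limit bB N0 bT (Tb N) TD Tc); case: Lv.
have Lf : (\int[mu]_(x in window N) (nrm (integrand T1 B N v x))%:E < +oo)%E.
  have [K K0 hK] := integrand_L1norm bB N0 bT (Tb N) TD Tc.
  by rewrite (le_lt_trans (hK _ Lv))// lte_mul_pinfty//; case: Lv.
have [z hz] : exists z, has_bochner_integral (window t0) (integrand T1 B N v) z.
  apply: (step_limit_bochner (mdom t0) (fdom t0) sf); apply: le_lt_trans Lf.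
  apply: ge0_subset_integral => //.
  - exact: step_limit_nrm_measurable.
  - by move=> x _; rewrite lee_fin nrm_ge0.
have := has_bochner_integral_extend (mdom t0) (mdom N) (fdom N) sub hz.
rewrite (_ : (fun x => _) = integrand T1 B N v) => [hz'|].
  by rewrite (has_bochner_integral_unique (mdom N) (fdom N) sf hy hz').
apply/funext => x; case: ifPn => // /negP h.
rewrite /integrand v0 ?(map0_linear bB.1) ?(map0_linear (bT (clip_ge0 _ _)).1)//.
by move=> h'; apply/h/mem_set.
Qed.

(** Markov's inequality at the level 2 i, read through the N-function. *)
Lemma level_measure (d : nat -> R) (d0 : forall i, 0 < d i) (N C : R) (v : R -> U) (i : nat) :
  step_limit v -> (0 < i)%N -> C <= i%:R ->
  (\int[mu]_(x in window N) (Nfun d (nrm (v x)))%:E <= C%:E)%E ->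
  (mu (window N `&` [set x | (i.*2%:R <= nrm (v x))%R]) <= (d i)%:E)%E.
Proof.
move=> sv i0 Ci hC; set E := [set x | (i.*2%:R <= nrm (v x))].
have mE : measurable E.
  exact: (measurable_superlevel i.*2%:R sv).
have mN : measurable_fun setT (fun x => Nfun d (nrm (v x))).
  apply: (measurableT_comp _ (step_limit_nrm sv)).
  by apply: nondecreasing_measurable => //; exact: Nfun_homo.
have h1 : ((Nfun d i.*2%:R)%:E * mu (window N `&` E) <= C%:E)%E.
  apply: le_trans hC; rewrite setIC -integral_indic// -ge0_integralZl//; last 2 first.
  - by apply/measurable_EFinP; exact: measurable_indic.
  - by rewrite lee_fin Nfun_ge0.
  apply: ge0_le_integral => //.
  - by move=> x _; rewrite mule_ge0// lee_fin Nfun_ge0.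
  - apply: measurable_funeM; apply/measurable_EFinP; exact: measurable_indic.
  - by apply/measurable_EFinP; exact: measurable_funS mN.
  - move=> x _; rewrite indicE; have [/set_mem xE|_] := boolP (x \in E).
      by rewrite mule1 lee_fin Nfun_homo.
    by rewrite mule0 lee_fin Nfun_ge0.
have fm : mu (window N `&` E) \is a fin_num by exact: (measure_setI_fin_num (mdom N) (fdom N)).
move: h1; rewrite -(fineK fm) -EFinM !lee_fin => h1.
have h2 := Nfun_even d0 i0.
set m := fine _ in h1 *; have m0 : 0 <= m by exact: fine_ge0.
have ip : 0 < i%:R :> R by rewrite ltr0n.
have i1 : 1 <= i%:R :> R by rewrite ler1n.
have dp := d0 i.
have h3 : i%:R ^+ 2 / d i * m <= i%:R.
  by rewrite (le_trans (ler_wpM2r m0 h2))// (le_trans h1).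
have h4 : i%:R * (i%:R * m) <= i%:R * d i.
  by move: h3; rewrite mulrAC ler_pdivrMr// expr2 -mulrA.
rewrite ler_pM2l// in h4; rewrite (le_trans _ h4)// ler_peMl//.
Qed.

Lemma admissible_Orlicz : exists Phi : R -> R, N_function Phi /\
  admissible j T1 (@L_Orlicz R U (fun t => (Phi t)%:E)) B.
Proof.
have [Q [bQ jQ]] := range_expansion q0 rb gd ex.
(* a measure threshold for each time horizon N + 1 and each level i; the horizon
   is handled here because Phi may not depend on t0 *)
pose small N i (d : R) := 0 < d /\
    forall v E, step_limit v -> measurable E -> (forall x, nrm (v x) <= 1) ->
      (forall x, ~ E x -> v x = 0) -> (mu (window N.+1%:R `&` E) <= d%:E)%E ->
    forall M, nrm (Q M (input_map T1 B N.+1%:R v)) <= 2^-1 ^+ i / i.+1.*2%:R.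
have /choice[del hdel] (N : nat) : exists del : nat -> R, forall i, small N i (del i).
  suff /choice[del hdel] i : exists d, small N i d by exists del.
  have N0 : 0 < N.+1%:R :> R by rewrite ltr0n.
  have e0 : 0 < 2^-1 ^+ i / i.+1.*2%:R :> R.
    by rewrite divr_gt0 ?exprn_gt0 ?ltr0n ?double_gt0.
  by have [d d0 hd] := expansion_absolute_continuity bQ jQ N0 e0; exists d.
(* a threshold at level i that suits all horizons up to i + 1 *)
pose d i := (\sum_(N < i.+1) (del N i)^-1)^-1.
have sum_gt0 i : 0 < \sum_(N < i.+1) (del N i)^-1.
  rewrite big_ord_recl/= ltr_pwDl ?invr_gt0 ?(hdel _ _).1// sumr_ge0// => k _.
  by rewrite invr_ge0 ltW// (hdel _ _).1.
have d0 i : 0 < d i by rewrite invr_gt0.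
have d_le N i : (N <= i)%N -> d i <= del N i.
  move=> Ni; have del0 := (hdel N i).1.
  rewrite -[del N i]invrK lef_pV2 ?posrE ?invr_gt0//.
  rewrite (bigD1 (inord N))//= inordK// lerDl sumr_ge0// => k _.
  by rewrite invr_ge0 ltW// (hdel _ _).1.
exists (Nfun d); split; first exact: Nfun_N_function.
split; first exact: bB.
move=> t0 t0p u [su [k k0 ik]].
have [v0 [sv0 v0z uv0]] := strongly_measurable_step_limit (mdom t0) su.
pose N := Num.truncn t0; have Np : 0 < N.+1%:R :> R by rewrite ltr0n.
have tN : t0 <= N.+1%:R by rewrite ltW// truncnS_gt.
pose c : R[i] := (k^-1)%:C.
have nc : nrm c = k^-1 by rewrite nrmR ger0_norm// invr_ge0 ltW.
(* the control read backwards in time, scaled so that Phi of its norm is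
   integrable *)
pose v x := c *: v0 (t0 - x).
have sv : step_limit v by apply: step_limitZ; exact: step_limit_reflect.
have reflect x : window t0 (t0 - x) <-> window t0 x.
  by rewrite /= !in_itv/=; split=> /andP[? ?]; apply/andP; split; lra.
have vz x : ~ window t0 x -> v x = 0.
  by move=> h; rewrite /v v0z ?scaler0// => /reflect.
have mPhi : measurable_fun setT (Nfun d).
  by apply: nondecreasing_measurable => //; exact: Nfun_homo.
have iv0 : (\int[mu]_(x in window N.+1%:R) (Nfun d (nrm (v x)))%:E < +oo)%E.
  apply: le_lt_trans ik.
  rewrite [leRHS](_ : _ = \int[mu]_(x in window t0) (Nfun d (k^-1 * nrm (v0 x)))%:E)%E.
    rewrite -(integral_reflect t0 (f := fun x => (Nfun d (k^-1 * nrm (v0 x)))%:E)); last 2 first.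
    - apply/measurable_EFinP; apply: (measurableT_comp mPhi).
      by apply: measurable_funM => //; exact: step_limit_nrm.
    - by move=> x; rewrite lee_fin Nfun_ge0.
    rewrite le_eqVlt; apply/orP; left; apply/eqP.
    rewrite integral_mkcond [RHS]integral_mkcond; apply: eq_integral => x _.
    rewrite /patch; have [h|h] := pselect (window t0 x).
      rewrite (mem_set h) mem_set; first by rewrite /v nrmZ nc.
      by move: h; rewrite /= !in_itv/= => /andP[-> /lt_le_trans ->].
    by rewrite (memNset h) vz// nrm0 Nfun0; case: (x \in window N.+1%:R).
  apply: ae_eq_integral_ge0 => [x|x|]; try by rewrite lee_fin Nfun_ge0.
  by move: uv0; apply: filterS => x h Dx; rewrite h.
have mv : measurable_fun (window (N.+1%:R : R)) (fun x => (Nfun d (nrm (v x)))%:E).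
  apply/measurable_EFinP.
  by apply: measurable_funS (measurableT_comp mPhi (step_limit_nrm sv)).
have Lv : L1fun (window N.+1%:R) v.
  split=> //.
  apply: (@le_lt_trans _ _ (\int[mu]_(x in window N.+1%:R)
      (cst 2%:E x + 2%:E * (Nfun d (nrm (v x)))%:E))%E).
    apply: ge0_le_integral => //.
    - by move=> x _; rewrite lee_fin nrm_ge0.
    - exact: step_limit_nrm_measurable.
    - by apply: emeasurable_funD => //; exact: measurable_funeM.
    - by move=> x _; rewrite /= -EFinM -EFinD lee_fin Nfun_superlinear// nrm_ge0.
  rewrite ge0_integralD//; last 3 first.
  - by move=> x _; rewrite lee_fin.
  - by move=> x _; rewrite mule_ge0// lee_fin Nfun_ge0.
  - exact: measurable_funeM.
  rewrite integral_cst// ge0_integralZl//; last first.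
    by move=> x _; rewrite lee_fin Nfun_ge0.
  apply: lte_add_pinfty; apply: lte_mul_pinfty => //; exact: fdom.
have [C hC] : exists C : R, (\int[mu]_(x in window N.+1%:R) (Nfun d (nrm (v x)))%:E <= C%:E)%E.
  exists (fine (\int[mu]_(x in window N.+1%:R) (Nfun d (nrm (v x)))%:E)); rewrite fineK//.
  by rewrite ge0_fin_numE// integral_ge0// => x _; rewrite lee_fin Nfun_ge0.
(* from level J0 on, the horizon is covered by the thresholds and Markov's
   inequality bounds the measure of the superlevel sets *)
pose J0 := maxn (maxn 1 N) (Num.truncn C).+1.
have [|x hx] := level_sets_range bQ jQ Np (J0 := J0) Lv.
  move=> i Ji w sw w1 wz M.
  have i0 : (0 < i)%N by rewrite (leq_trans _ Ji)// !leq_max.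
  have Ni : (N <= i)%N by rewrite (leq_trans _ Ji)// !leq_max leqnn orbT.
  have Ci : C <= i%:R.
    rewrite (le_trans (ltW (truncnS_gt C)))// ler_nat (leq_trans _ Ji)//.
    by rewrite leq_max leqnn orbT.
  have mE := measurable_superlevel i.*2%:R sv.
  apply: ((hdel N i).2 w _ sw mE w1 wz).
  rewrite (le_trans (level_measure d0 sv i0 Ci hC))// lee_fin.
  exact: d_le.
have N0 := ltW Np.
have h1 := input_mapP bB N0 bT (Tb _) TD Tc Lv.
have h2 := has_bochner_integral_sub t0p tN Lv vz h1.
have si : step_limit (integrand T1 B N.+1%:R v).
  exact: (integrand_step_limit bB N0 bT (Tb _) TD Tc).
have h3 := has_bochner_integral_reflect si h2.
have h4 := has_bochner_integralZ (mdom t0) (fdom t0) k%:C (step_limit_reflect t0 si) h3.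
have [lj _ _ _] := ex.
exists (k%:C *: x); rewrite (mapZ_linear _ lj) hx.
apply: has_bochner_integral_ae h4; move: uv0; apply: filterS => s h Ds.
rewrite h//; have := Ds; rewrite /= in_itv/= => /andP[s0 st].
rewrite -(integrandZ N.+1%:R bB bT) /integrand clip_id; [|lra|lra].
rewrite /v scalerA -rmorphM/= mulfV ?gt_eqF// scale1r.
by rewrite subKr.
Qed.

End Admissibility.

Theorem corollary3p7 (R : realType) (q : R) (X : completeNormedModType R[i])
    (phi : int -> X) (A : operator X) (T : R -> X -> X)
    (X1 : completeNormedModType R[i]) (j : X -> X1) (T1 : R -> X1 -> X1)
    (n : nat) :
  2 <= q ->
  riesz_basis q phi ->
  generates_diagonal phi A T ->
  extrapolation A T j T1 ->
  forall B : 'cV[R[i]]_n -> X1,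
    admissible j T1 (@L_infty R 'cV[R[i]]_n) B ->
    exists Phi : R -> R,
      N_function Phi /\
      admissible j T1
        (@L_Orlicz R 'cV[R[i]]_n (fun t => (Phi t)%:E)) B.

Proof.
move=> q2 rb gd ex B adm; apply: (admissible_Orlicz _ rb gd ex adm).
by rewrite (lt_le_trans _ q2).
Qed.
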